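(* The invariant ring $\mathbb{F}[V]^{SL_2(\mathbb{F}_q)}$ is generated as an $\mathbb{F}$-algebra by $\Delta$, $J$, $\Gamma$ and $B$, subject to a relation of the form $$B^2=\Delta^q\Gamma^2+J\,\Phi(\Delta,J,\Gamma)$$ for some polynomial $\Phi$. Furthermore, $\{\Delta,J,\Gamma,B\}$ is a SAGBI basis for $\mathbb{F}[V]^{SL_2(\mathbb{F}_q)}$ with respect to the graded reverse lexicographic order with $a_0<a_1<a_2$.
   Context: Let $p>2$ be a prime, $q=p^n$, and $\mathbb{F}$ a field of characteristic $p$ containing $\mathbb{F}_q$. Let $\mathbb{F}[V]=\mathbb{F}[a_0,a_1,a_2]$. The group $GL_2(\mathbb{F})$ (hence $SL_2(\mathbb{F}_q)$) acts on the right on $\mathbb{F}[a_0,a_1,a_2]$ by algebra automorphisms: for $g=\begin{pmatrix}\alpha&\beta'\\ \gamma'&\delta\end{pmatrix}$, $a_2 g=\alpha^2a_2+2\alpha\beta' a_1+\beta'^2a_0$, $a_1g=\alpha\gamma' a_2+(\alpha\delta+\beta'\gamma')a_1+\beta'\delta a_0$, $a_0g=\gamma'^2a_2+2\gamma'\delta a_1+\delta^2a_0$. For a subgroup $G$, $\mathbb{F}[V]^G$ is the ring of $G$-invariant polynomials. Define $\Delta=a_1^2-a_0a_2$, $\beta=\prod_{c\in\mathbb{F}_q}(a_1+ca_0)$, and for $k\in\mathbb{F}_q$, $\gamma_k=\prod_{c\in\mathbb{F}_q}(a_2+2ca_1+(c^2-k)a_0)$. Let $\mathcal{Q}$ be the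 set of nonzero quadratic residues in $\mathbb{F}_q$ (even powers of a generator of $\mathbb{F}_q^*$) and $\overline{\mathcal{Q}}$ the set of quadratic nonresidues (odd powers). Define $\Gamma=\prod_{k\in\overline{\mathcal{Q}}}\gamma_k$, $B=\beta\prod_{k\in\mathcal{Q}}\gamma_k$, $J=a_0\gamma_0$. A SAGBI basis of a subalgebra $R$ of a polynomial ring (w.r.t. a monomial order) is a subset of $R$ whose lead monomials generate the algebra of lead monomials of elements of $R$. *)

(* Defs.v *)
From HB Require Import structures.
From mathcomp Require Import all_boot all_order all_algebra.
From mathcomp Require Import mpoly.
Set Implicit Arguments. Unset Strict Implicit. Unset Printing Implicit Defensive.
Import GRing.Theory.
Local Open Scope ring_scope.

(* Convention: F[V] = F[a0,a1,a2] is {mpoly F[3]} with a_i = 'X_i (i = 0,1,2).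
   F_q inside F is given as an explicit duplicate-free list [s] of q elements
   satisfying c^q = c (these are then exactly the elements of F_q).           *)

Definition o0 : 'I_3 := ord0.
Definition o1 : 'I_3 := inord 1.
Definition o2 : 'I_3 := inord 2.

Section Defs.
Variable F : fieldType.

Definition a0 : {mpoly F[3]} := 'X_o0.
Definition a1 : {mpoly F[3]} := 'X_o1.
Definition a2 : {mpoly F[3]} := 'X_o2.

Definition is_Fq (q : nat) (s : seq F) : Prop :=
  [/\ uniq s, size s = q & forall c, c \in s -> c ^+ q = c].

(* the right action of g = [[alpha, beta'], [gamma', delta]] on F[a0,a1,a2]:
   the algebra endomorphism sending a0, a1, a2 to a0 g, a1 g, a2 g. *)
Definition act (g : 'M[F]_2) (f : {mpoly F[3]}) : {mpoly F[3]} :=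
  let al := g 0 0 in let be := g 0 1 in let ga := g 1 0 in let de := g 1 1 in
  f \mPo [tuple
    (ga ^+ 2) *: a2 + (2 * ga * de) *: a1 + (de ^+ 2) *: a0;
    (al * ga) *: a2 + (al * de + be * ga) *: a1 + (be * de) *: a0;
    (al ^+ 2) *: a2 + (2 * al * be) *: a1 + (be ^+ 2) *: a0].

Definition inSL2 (s : seq F) (g : 'M[F]_2) : Prop :=
  (forall i j, g i j \in s) /\ \det g = 1.

Definition sl2_invariant (s : seq F) (f : {mpoly F[3]}) : Prop :=
  forall g, inSL2 s g -> act g f = f.

Definition Delta : {mpoly F[3]} := a1 ^+ 2 - a0 * a2.
Definition beta (s : seq F) : {mpoly F[3]} := \prod_(c <- s) (a1 + c *: a0).
Definition gamma (s : seq F) (k : F) : {mpoly F[3]} :=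
  \prod_(c <- s) (a2 + (2 * c) *: a1 + (c ^+ 2 - k) *: a0).

Definition qres (s : seq F) : seq F :=
  [seq k <- s | (k != 0) && has (fun x => x ^+ 2 == k) s].
Definition qnonres (s : seq F) : seq F :=
  [seq k <- s | (k != 0) && ~~ has (fun x => x ^+ 2 == k) s].

Definition Gam (s : seq F) : {mpoly F[3]} := \prod_(k <- qnonres s) gamma s k.
Definition BB (s : seq F) : {mpoly F[3]} := beta s * \prod_(k <- qres s) gamma s k.
Definition JJ (s : seq F) : {mpoly F[3]} := a0 * gamma s 0.

Definition grevlex_lt (m m' : 'X_{1..3}) : bool :=
  (mdeg m < mdeg m')%N ||
  ((mdeg m == mdeg m') &&
   ((m' o0 < m o0)%N || ((m o0 == m' o0) && (m' o1 < m o1)%N))).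

(* lead monomial w.r.t. grevlex (meaningful for f != 0) *)
Definition lmon (f : {mpoly F[3]}) : 'X_{1..3} :=
  foldr (fun m acc => if grevlex_lt acc m then m else acc) 0%MM (msupp f).

(* SAGBI basis: the lead monomials of the (invariant) basis elements generate
   the algebra spanned by the lead monomials of nonzero elements of R,
   i.e. every such lead monomial is a product of lead monomials of the basis. *)
Definition is_SAGBI (R : {mpoly F[3]} -> Prop) (b : seq {mpoly F[3]}) : Prop :=
  (forall x, x \in b -> R x) /\
  forall f, R f -> f != 0 ->
    exists e : seq nat, size e = size b /\
      ('X_[lmon f] : {mpoly F[3]}) =
        \prod_(i < size b) 'X_[lmon (nth 0 b i)] ^+ nth 0%N e i.

(* The relation polynomial in F[x0,x1,x2,x3] (x0,x1,x2,x3 standing for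
   Delta, J, Gamma, B):  x3^2 - x0^q x2^2 - x1 Phi(x0,x1,x2). *)
Definition relpoly (q : nat) (Phi : {mpoly F[3]}) : {mpoly F[4]} :=
  let x0 : {mpoly F[4]} := 'X_(inord 0) in let x1 : {mpoly F[4]} := 'X_(inord 1) in
  let x2 : {mpoly F[4]} := 'X_(inord 2) in let x3 : {mpoly F[4]} := 'X_(inord 3) in
  x3 ^+ 2 - x0 ^+ q * x2 ^+ 2 - x1 * (Phi \mPo [tuple x0; x1; x2]).

End Defs.

(* Main.v *)
(** Write D = Delta, and let r be the reflection a1 -> -a1, which normalizes
    the group. An invariant splits into an r-even and an r-odd invariant.
    An r-odd one is divisible by a1, hence by all the conjugate linear forms,
    whose product is B (up to a scalar); the quotient is r-even.
    Modulo a0, an r-even invariant is fixed by the shears a2 -> a2 + 2 b a1 and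
    the torus a2 -> a^2 a2, hence is a polynomial in a1^2 (the image of D) and
    N^((q-1)/2) (the image of Gamma), where N is the product of the
    a2 + 2 c a1. After subtracting a polynomial in D and Gamma, of no larger
    degree, the invariant is divisible by a0, hence by its orbit product J, and
    one concludes by induction on the degree. So the invariants are A + B A
    with A = F[D, J, Gamma]. The lead monomials of D^i J^j Gamma^k B^e with
    e = 0, 1 are pairwise distinct, which gives the SAGBI property and the
    freeness of A + B A. *)
Require Import Defs.
From HB Require Import structures.
From mathcomp Require Import all_boot all_order all_algebra.
From mathcomp Require Import mpoly.
From mathcomp Require Import ring zify.
Import GRing.Theory.
Local Open Scope ring_scope.
Set Implicit Arguments. Unset Strict Implicit. Unset Printing Implicit Defensive.

(** * Substitutions and the action on binary quadratic forms *)

(** Read u a2 + v a1 + w a0 as the binary quadratic form u X^2 + v X Y + w Y^2. The action becomes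
    linear substitution in X and Y, and the discriminant v^2 - 4 u w is multiplied by the square of
    the determinant. Up to scalars, the nonzero forms over F_q fall into three classes, of
    discriminant zero, nonresidue and nonzero square; J, Gamma and B are the products over these
    classes, of degrees q + 1, q(q-1)/2 and q(q+1)/2. Invariance of these products is therefore a
    matter of divisibility: the exchange of X and Y permutes each class up to scalars, and the sign
    that remains cancels because a lower shear is an upper shear conjugated by the exchange.
    Conversely, a0 is Y^2 and a1 is XY, and a factorization of a form into linear factors in X and Y
    gives the rows of a matrix carrying a0 or a1 to it. The exponent (q-1)/2 comes from the torus:
    it multiplies N by a^2, so N^e survives only if a^(2e) = 1 for every nonzero a in F_q. *)

Lemma det_mx22 (R : comNzRingType) (A : 'M[R]_2) :
  \det A = A 0 0 * A 1 1 - A 0 1 * A 1 0.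
Proof.
rewrite (expand_det_row _ 0) !big_ord_recl big_ord0 addr0 /cofactor !det_mx11 !mxE /=.
rewrite expr0 expr1 mul1r mulN1r mulrN.
by congr (A _ _ * A _ _ - A _ _ * A _ _); apply/val_inj.
Qed.

Section Substitution.
Variable F : fieldType.
Implicit Types (f u v w : {mpoly F[3]}).

Lemma o1E : o1 = 1%N :> nat. Proof. by rewrite inordK. Qed.
Lemma o2E : o2 = 2%N :> nat. Proof. by rewrite inordK. Qed.

Lemma big_ord3 (T : Type) (idx : T) (op : Monoid.law idx) (G : 'I_3 -> T) :
  \big[op/idx]_(i < 3) G i = op (op (G o0) (G o1)) (G o2).
Proof.
rewrite !big_ord_recl big_ord0 Monoid.mulm1 Monoid.mulmA.
by congr (op (op (G _) (G _)) (G _)); apply/val_inj; rewrite /= ?o1E ?o2E.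
Qed.

Section Comp3.
Variables (k : nat) (u v w : {mpoly F[k]}).
Local Notation T := [tuple u; v; w].

Lemma comp3_a0 : a0 F \mPo T = u. Proof. by rewrite comp_mpolyXU. Qed.
Lemma comp3_a1 : a1 F \mPo T = v. Proof. by rewrite comp_mpolyXU o1E. Qed.
Lemma comp3_a2 : a2 F \mPo T = w. Proof. by rewrite comp_mpolyXU o2E. Qed.
Definition comp3_var := (comp3_a0, comp3_a1, comp3_a2).

Lemma comp3E f : f \mPo T =
  \sum_(m <- msupp f) f@_m *: (u ^+ m o0 * v ^+ m o1 * w ^+ m o2).
Proof.
rewrite comp_mpolyE; apply: eq_bigr => m _; congr (_ *: _).
by rewrite big_ord3 /= !(tnth_nth 0) o1E o2E.
Qed.
End Comp3.

Lemma comp3A k l (u v w : {mpoly F[l]}) (lp : l.-tuple {mpoly F[k]}) f :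
  (f \mPo [tuple u; v; w]) \mPo lp =
  f \mPo [tuple u \mPo lp; v \mPo lp; w \mPo lp].
Proof.
rewrite !comp3E raddf_sum; apply: eq_bigr => m _.
by rewrite /= comp_mpolyZ !rmorphM !rmorphXn.
Qed.

Lemma comp3_id f : f \mPo [tuple a0 F; a1 F; a2 F] = f.
Proof.
rewrite -[RHS]comp_mpoly_id; congr (_ \mPo _); apply: eq_from_tnth => i.
rewrite tnth_mktuple (tnth_nth 0).
case: i => [[|[|[|//]]] lti] /=; congr 'X_[_]; congr (U_(_))%MM; apply/val_inj => /=;
 by rewrite ?o1E ?o2E.
Qed.

(** The symmetric square of the matrix (a, b; c, d). Separate scalar entries let [ring] check
    compositions, and admit matrices of determinant -1 such as (0, 1; 1, 0) and diag(1, -1). *)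
Definition sqt (a b c d : F) : 3.-tuple {mpoly F[3]} :=
   [tuple
    (c ^+ 2) *: a2 F + (2 * c * d) *: a1 F + (d ^+ 2) *: a0 F;
    (a * c) *: a2 F + (a * d + b * c) *: a1 F + (b * d) *: a0 F;
    (a ^+ 2) *: a2 F + (2 * a * b) *: a1 F + (b ^+ 2) *: a0 F].
Definition qact a b c d f := f \mPo sqt a b c d.

Lemma qactD a b c d : {morph qact a b c d : f g / f + g}.
Proof. exact: comp_mpolyD. Qed.
Lemma qactB a b c d : {morph qact a b c d : f g / f - g}.
Proof. exact: comp_mpolyB. Qed.
Lemma qactM a b c d : {morph qact a b c d : f g / f * g}.
Proof. by move=> f g; rewrite /qact rmorphM. Qed.
Lemma qactX a b c d k : {morph qact a b c d : f / f ^+ k}.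
Proof. by move=> f; rewrite /qact rmorphXn. Qed.
Lemma qactZ a b c d e : {morph qact a b c d : f / e *: f}.
Proof. by move=> f; rewrite /qact comp_mpolyZ. Qed.
Lemma qact0 a b c d : qact a b c d 0 = 0. Proof. exact: comp_mpoly0. Qed.
Lemma qact_prod a b c d (I : Type) (r : seq I) (G : I -> {mpoly F[3]}) :
  qact a b c d (\prod_(i <- r) G i) = \prod_(i <- r) qact a b c d (G i).
Proof. by rewrite /qact rmorph_prod. Qed.
Lemma qact_a0 a b d : qact a b 0 d (a0 F) = d ^+ 2 *: a0 F.
Proof. by rewrite /qact comp3_var expr0n mulr0 mul0r !scale0r !add0r. Qed.

Lemma eq_qact a b c d a' b' c' d' f :
  a = a' -> b = b' -> c = c' -> d = d' -> qact a b c d f = qact a' b' c' d' f.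
Proof. by move=> -> -> -> ->. Qed.

Lemma qactA a b c d a' b' c' d' f : qact a' b' c' d' (qact a b c d f) =
  qact (a * a' + b * c') (a * b' + b * d') (c * a' + d * c') (c * b' + d * d') f.
Proof.
rewrite /qact comp3A; congr (_ \mPo _).
apply/val_inj; rewrite /= !comp_mpolyD !comp_mpolyZ !comp3_var -!mul_mpolyC.
by congr [:: _; _; _]; ring.
Qed.
End Substitution.

(** * The subfield of order q *)

Definition odd_Fq (p n : nat) (F : fieldType) (s : seq F) :=
  [/\ prime p, (2 < p)%N, (0 < n)%N, p \in [pchar F] & is_Fq (p ^ n) s].

Section FiniteSubfield.
Variables (p n : nat) (F : fieldType) (s : seq F).
Hypothesis sP : odd_Fq p n s.
Let p_pr : prime p. Proof. by case: sP. Qed.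
Let p_gt2 : (2 < p)%N. Proof. by case: sP. Qed.
Let n_gt0 : (0 < n)%N. Proof. by case: sP. Qed.
Let pcharFp : p \in [pchar F]. Proof. by case: sP. Qed.
Let Fq_s : is_Fq (p ^ n) s. Proof. by case: sP. Qed.
Let q := (p ^ n)%N.

Lemma Fq_uniq : uniq s. Proof. by case: Fq_s. Qed.
Lemma Fq_size : size s = q. Proof. by case: Fq_s. Qed.

Lemma q_gt2 : (2 < q)%N.
Proof.
apply: leq_trans p_gt2 _; rewrite /q -(prednK n_gt0) expnS.
by rewrite leq_pmulr // expn_gt0 prime_gt0.
Qed.

Lemma q_odd : odd q.
Proof. by rewrite /q oddX; case/even_prime: p_pr p_gt2 => -> // _; rewrite orbT. Qed.

Lemma two_neq0 : 2 != 0 :> F.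
Proof.
rewrite -(dvdn_pcharf pcharFp); apply/negP => /dvdn_leq => /(_ isT).
by rewrite leqNgt p_gt2.
Qed.

(** [s] already holds q roots of X^q - X, so one more would exceed the degree. Closure of [s] under
    the field operations then reduces to identities between q-th powers. *)
Lemma mem_Fq c : (c \in s) = (c ^+ q == c).
Proof.
apply/idP/eqP => [|cq]; first by case: Fq_s => _ _; apply.
apply/negPn/negP => c_s.
have sz : size ('X^q - 'X : {poly F}) = q.+1.
  rewrite size_polyDl ?size_polyXn // size_polyN size_polyX ltnS.
  exact: ltnW q_gt2.
have := @max_poly_roots _ ('X^q - 'X : {poly F}) (c :: s).
rewrite -size_poly_eq0 sz /= c_s Fq_uniq Fq_size ltnn => /(_ isT) H.
suff: false by []. apply: H => //.
rewrite /root !hornerE /= cq subrr eqxx /=; apply/allP => x xs.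
case: Fq_s => _ _ /(_ x xs) xq.
by rewrite /root !hornerE /= -/q xq subrr.
Qed.

Lemma Fq0 : 0 \in s. Proof. by rewrite mem_Fq expr0n (gtn_eqF (ltnW (ltnW q_gt2))). Qed.
Lemma Fq1 : 1 \in s. Proof. by rewrite mem_Fq expr1n. Qed.
Lemma FqM x y : x \in s -> y \in s -> x * y \in s.
Proof. by rewrite !mem_Fq exprMn => /eqP -> /eqP ->. Qed.
Lemma FqX x k : x \in s -> x ^+ k \in s.
Proof. by move=> xs; elim: k => [|k IH]; rewrite ?expr0 ?Fq1 // exprS FqM. Qed.
Lemma FqV x : x \in s -> x^-1 \in s.
Proof. by rewrite !mem_Fq exprVn => /eqP ->. Qed.
Lemma FqD x y : x \in s -> y \in s -> x + y \in s.
Proof.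
rewrite !mem_Fq exprDn_pchar; first by move=> /eqP -> /eqP ->.
by rewrite pnatX pnatE // pcharFp.
Qed.
Lemma FqN x : x \in s -> - x \in s.
Proof. by rewrite !mem_Fq exprNn -signr_odd q_odd expr1 mulN1r => /eqP ->. Qed.
Lemma FqB x y : x \in s -> y \in s -> x - y \in s.
Proof. by move=> xs ys; rewrite FqD // FqN. Qed.
Lemma Fq_nat k : k%:R \in s.
Proof. by elim: k => [|k IH]; rewrite ?Fq0 // mulrS FqD // Fq1. Qed.

Lemma perm_Fq (h : F -> F) :
  {in s &, injective h} -> {in s, forall c, h c \in s} -> perm_eq (map h s) s.
Proof.
move=> h_inj hs; have u : uniq (map h s) by rewrite map_inj_in_uniq ?Fq_uniq.
apply: uniq_perm => //; first exact: Fq_uniq.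
have sub : {subset map h s <= s} by move=> _ /mapP[x xs ->]; exact: hs.
by have [|_] := uniq_min_size u sub; rewrite ?size_map.
Qed.

Lemma big_Fq_reindex (T : Type) (idx : T) (op : Monoid.com_law idx)
    (h : F -> F) (G : F -> T) :
  {in s &, injective h} -> {in s, forall c, h c \in s} ->
  \big[op/idx]_(c <- s) G (h c) = \big[op/idx]_(c <- s) G c.
Proof. by move=> h_inj hs; rewrite -[RHS](perm_big _ (perm_Fq h_inj hs)) big_map. Qed.

Lemma FqX_pred x : x \in s -> x != 0 -> x ^+ q.-1 = 1.
Proof.
rewrite mem_Fq => xq x0; apply: (mulfI x0); rewrite mulr1 -exprS prednK ?(eqP xq) //.
exact: leq_trans q_gt2.
Qed.

Let r := q.-1./2.

Lemma q_pred : q.-1 = r.*2.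
Proof.
rewrite /r -[LHS]odd_double_half; case E : (odd _) => //.
by have := q_odd; rewrite -(prednK (ltnW (ltnW q_gt2))) /= E.
Qed.

Lemma r_gt0 : (0 < r)%N.
Proof. by have := q_gt2; have := q_pred; case: r => //; case: q => [|[|[|]]]. Qed.

Lemma mem_qres k :
  reflect (exists2 x, x \in s & x != 0 /\ k = x ^+ 2) (k \in qres s).
Proof.
rewrite mem_filter; apply: (iffP idP) => [/andP[/andP[k0 /hasP[x xs /eqP xk]] _]|].
  by exists x => //; split=> //; apply: contraNneq k0 => x0; rewrite -xk x0 expr0n.
case=> x xs [x0 ->]; rewrite sqrf_eq0 x0 FqX // andbT /=.
by apply/hasP; exists x.
Qed.

Lemma mem_qnonres k :
  (k \in qnonres s) = [&& k \in s, k != 0 & ~~ has (fun x => x ^+ 2 == k) s].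
Proof. by rewrite mem_filter andbC. Qed.

Lemma count_neq0 : size [seq x <- s | x != 0] = r.*2.
Proof.
rewrite -q_pred -Fq_size (perm_size (perm_to_rem Fq0)) /=.
by rewrite rem_filter ?Fq_uniq.
Qed.

(** The squares are roots of X^r - 1, hence at most r in number. Conversely, each of the 2r nonzero
    elements is, up to sign, the square root [sq] chosen for its square. *)
Lemma size_qres : size (qres s) = r.
Proof.
apply/eqP; rewrite eqn_leq; apply/andP; split.
  have sz : size ('X^r - 1 : {poly F}) = r.+1 by rewrite size_XnsubC // r_gt0.
  rewrite -ltnS -sz; apply: max_poly_roots.
  - by rewrite -size_poly_eq0 sz.
  - apply/allP => k /mem_qres[x xs [x0 ->]].
    by rewrite /root !hornerE -exprM mul2n -q_pred FqX_pred // subrr.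
  - exact/filter_uniq/Fq_uniq.
rewrite -leq_double -count_neq0.
pose sq k := nth 0 s (find (fun x => x ^+ 2 == k) s).
have -> : (size (qres s)).*2 = size (map sq (qres s) ++ map (fun k => - sq k) (qres s)).
  by rewrite size_cat !size_map addnn.
apply: uniq_leq_size; first exact/filter_uniq/Fq_uniq.
move=> x; rewrite mem_filter => /andP[x0 xs].
have kq : x ^+ 2 \in qres s by apply/mem_qres; exists x.
have : sq (x ^+ 2) ^+ 2 == x ^+ 2.
  by apply: (@nth_find _ 0 (fun y => y ^+ 2 == x ^+ 2)); apply/hasP; exists x.
rewrite eqf_sqr mem_cat => /orP[] /eqP e; apply/orP; [left|right]; apply/mapP;
  by exists (x ^+ 2) => //; rewrite e ?opprK.
Qed.

Lemma size_qnonres : size (qnonres s) = r.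
Proof.
have := count_neq0.
rewrite -(count_predC (fun k => has (fun x => x ^+ 2 == k) s)).
rewrite !count_filter -!size_filter.
have -> : [seq k <- s | predI (fun k => has (fun x => x ^+ 2 == k) s) (fun k => k != 0) k] = qres s.
  by apply: eq_filter => k; rewrite /= andbC.
have -> : [seq k <- s | predI (predC (fun k => has (fun x => x ^+ 2 == k) s)) (fun k => k != 0) k] = qnonres s.
  by apply: eq_filter => k; rewrite /= andbC.
by rewrite size_qres -addnn => /addnI.
Qed.

(** Counting roots takes the place of a generator of the cyclic group: the remainder v of j modulo r
    satisfies the same hypothesis, and for 0 < v < r the polynomial X^(2v) - 1 would have 2r
    roots. *)
Lemma dvdn_exponent j :
  {in s, forall x, x != 0 -> x ^+ (2 * j) = 1} -> (r %| j)%N.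
Proof.
move=> H; rewrite /dvdn; apply/eqP; set v := (j %% r)%N.
have v_lt : (v < r)%N by rewrite ltn_mod r_gt0.
case: (posnP v) => // v_gt0.
have Hv : {in s, forall x, x != 0 -> x ^+ (2 * v) = 1}.
  move=> x xs x0; rewrite -[RHS](H x xs x0) [in RHS](divn_eq j r) -/v mulnDr exprD.
  by rewrite mulnCA (mul2n r) -q_pred (mulnC (j %/ r)%N) (exprM x q.-1) FqX_pred // expr1n mul1r.
have sz : size ('X^(2 * v) - 1 : {poly F}) = (2 * v).+1.
  by rewrite size_XnsubC // muln_gt0.
have := @max_poly_roots _ ('X^(2 * v) - 1 : {poly F}) [seq x <- s | x != 0].
rewrite -size_poly_eq0 sz count_neq0 filter_uniq ?Fq_uniq // ltnS mul2n leq_double.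
rewrite leqNgt v_lt => H'; suff: false by []. apply: H' => //.
apply/allP => x; rewrite mem_filter => /andP[x0 xs].
by rewrite /root !hornerE -mul2n Hv // subrr.
Qed.

End FiniteSubfield.

(** * Linear forms *)

Section LinearForms.
Variable F : fieldType.
Implicit Types (f g h d u v w : {mpoly F[3]}) (t : F * F * F).

Definition mdvd d f := exists h, f = d * h.

Lemma mdvdD d f g : mdvd d f -> mdvd d g -> mdvd d (f + g).
Proof. by move=> [h ->] [h' ->]; exists (h + h'); rewrite mulrDr. Qed.
Lemma mdvdM d f g : mdvd d f -> mdvd d (g * f).
Proof. by move=> [h ->]; exists (g * h); rewrite mulrCA. Qed.
Lemma mdvd_sub_exp d u v k : mdvd d (u - v) -> mdvd d (u ^+ k - v ^+ k).
Proof. by move=> [h e]; rewrite subrXX e -mulrA; eexists. Qed.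
Lemma mdvd_sub_mul d u v u' v' :
  mdvd d (u - u') -> mdvd d (v - v') -> mdvd d (u * v - u' * v').
Proof.
move=> du dv; have -> : u * v - u' * v' = v * (u - u') + u' * (v - v') by ring.
by apply: mdvdD; apply: mdvdM.
Qed.

(** With the variables as u, v, w this is a factor theorem: d divides f as soon as f vanishes under
    a substitution congruent to the identity modulo d. *)
Lemma mdvd_comp3_sub d u v w u' v' w' f :
  mdvd d (u - u') -> mdvd d (v - v') -> mdvd d (w - w') ->
  mdvd d ((f \mPo [tuple u; v; w]) - (f \mPo [tuple u'; v'; w'])).
Proof.
move=> du dv dw; rewrite !comp3E; rewrite -sumrB; elim/big_rec: _ => [|m g _].
  by exists 0; rewrite mulr0.
apply: mdvdD; rewrite -scalerBr -mul_mpolyC; apply: mdvdM.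
by do 2?[apply: mdvd_sub_mul]; apply: mdvd_sub_exp.
Qed.

Definition lin t : {mpoly F[3]} := t.1.1 *: a2 F + t.1.2 *: a1 F + t.2 *: a0 F.

Lemma comp3_lin k (u v w : {mpoly F[k]}) t :
  lin t \mPo [tuple u; v; w] = t.1.1 *: w + t.1.2 *: v + t.2 *: u.
Proof. by rewrite !comp_mpolyD !comp_mpolyZ !comp3_var. Qed.

Lemma mcoeff_lin t :
  [/\ (lin t)@_U_(o2) = t.1.1, (lin t)@_U_(o1) = t.1.2 & (lin t)@_U_(o0) = t.2].
Proof.
by split; rewrite !mcoeffD !mcoeffZ !mcoeffXU -!val_eqE /= !o1E ?o2E /=;
  rewrite ?mulr0 ?mulr1 ?add0r ?addr0.
Qed.

Lemma lin_inj : injective lin.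
Proof.
move=> [[u v] w] [[u' v'] w'] e.
have [/= eu ev ew] := mcoeff_lin (u, v, w).
by have [/=] := mcoeff_lin (u', v', w'); rewrite -e eu ev ew => -> -> ->.
Qed.

Lemma lin0 : lin (0, 0, 0) = 0. Proof. by rewrite /lin !scale0r !addr0. Qed.

Lemma lin_eq0 t : (lin t == 0) = (t == (0, 0, 0)).
Proof. by rewrite -lin0 (inj_eq lin_inj). Qed.

Lemma lin_scale c t : lin (c * t.1.1, c * t.1.2, c * t.2) = c *: lin t.
Proof. by rewrite /lin !scalerDr !scalerA. Qed.

Lemma msize_lin t : t != (0, 0, 0) -> msize (lin t) = 2%N.
Proof.
move=> t0; apply/eqP; rewrite eqn_leq; apply/andP; split.
  have szX c (i : 'I_3) : (msize (c *: 'X_i : {mpoly F[3]}) <= 2)%N.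
    by apply: leq_trans (msizeZ_le _ _) _; rewrite msizeX mdeg1.
  do 2![apply: leq_trans (msizeD_le _ _) _; rewrite geq_max szX ?andbT].
  exact: szX.
have [i] : exists i, (lin t)@_U_(i) != 0.
  have [e2 e1 e0] := mcoeff_lin t; case: t t0 e2 e1 e0 => [[u v] w] /= t0 e2 e1 e0.
  have [u0|] := eqVneq u 0; last by exists o2; rewrite e2.
  have [v0|] := eqVneq v 0; last by exists o1; rewrite e1.
  by exists o0; rewrite e0; apply: contraNneq t0 => ->; rewrite u0 v0.
by rewrite -mcoeff_msupp => /msize_mdeg_lt; rewrite mdeg1.
Qed.

(** One representative of each nonzero linear form up to scalars: distinct normal triples give
    non-associate forms. *)
Definition normal t :=
  [|| t.1.1 == 1, (t.1.1 == 0) && (t.1.2 == 1) | [&& t.1.1 == 0, t.1.2 == 0 & t.2 == 1]].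

Lemma normal_neq0 t : normal t -> t != (0, 0, 0).
Proof.
by apply: contraTneq => ->; rewrite /normal /= !(eq_sym 0) !oner_eq0 !andbF.
Qed.

Lemma normal_scale_inj c t : normal t -> normal (c * t.1.1, c * t.1.2, c * t.2) -> 
  (c * t.1.1, c * t.1.2, c * t.2) = t.
Proof.
have [->|c0] := eqVneq c 0.
  by move=> _ /normal_neq0; rewrite !mul0r eqxx.
case: t => [[u v] w]; rewrite /normal /= !mulf_eq0 (negPf c0) /=.
have n10 : (1 == 0 :> F) = false by rewrite oner_eq0.
case/or3P=> [/eqP->|/andP[/eqP-> /eqP->]|/and3P[/eqP-> /eqP-> /eqP->]];
  by rewrite ?mulr1 ?mulr0 ?n10 ?eqxx ?(eq_sym 0) ?n10 /= ?orbF => /eqP ->; rewrite ?mul1r.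
Qed.

(* Setting the leading variable of [lin t] to its value on the plane
   [lin t = 0] is a morphism to a domain whose kernel is generated by [lin t]. *)
Lemma normal_lin_prime t : normal t ->
  exists T : 3.-tuple {mpoly F[3]},
    (forall f, mdvd (lin t) f <-> f \mPo T = 0) /\
    (forall t', normal t' -> lin t' \mPo T = 0 -> t' = t).
Proof.
move=> nt; suff [u [v [w [du dv dw l0 H]]]] : exists u v w,
    [/\ mdvd (lin t) (a0 F - u), mdvd (lin t) (a1 F - v), mdvd (lin t) (a2 F - w),
     lin t \mPo [tuple u; v; w] = 0 &
     forall t', lin t' \mPo [tuple u; v; w] = 0 ->
       exists c, t' = (c * t.1.1, c * t.1.2, c * t.2)].
  exists [tuple u; v; w]; split=> [f|t' nt' /H[c e]].
    split=> [[h ->]|f0]; first by rewrite rmorphM /= l0 mul0r.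
    by rewrite -[f]subr0 -f0 -{1}[f]comp3_id; apply: mdvd_comp3_sub.
  by move: nt'; rewrite e; apply: normal_scale_inj.
case: t nt => [[u v] w]; rewrite /normal /=.
have d0 d f : mdvd d (f - f) by exists 0; rewrite subrr mulr0.
have lE x y z : lin (x, y, z) = x *: a2 F + y *: a1 F + z *: a0 F by [].
case/or3P=> [/eqP->|/andP[/eqP-> /eqP->]|/and3P[/eqP-> /eqP-> /eqP->]].
- exists (a0 F), (a1 F), (- (v *: a1 F + w *: a0 F)); split=> //.
  + by exists 1; rewrite mulr1 opprK lE scale1r addrA.
  + by rewrite comp3_lin /= scale1r -addrA addNr.
  move=> [[x y] z]; rewrite comp3_lin /= => e; exists x.
  have /eqP : lin (0, y - x * v, z - x * w) = 0.
    by rewrite -[RHS]e lE -!mul_mpolyC; ring.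
  by rewrite lin_eq0 !xpair_eqE !subr_eq0 mulr1 => /andP[/andP[_ /eqP->] /eqP->].
- exists (a0 F), (- (w *: a0 F)), (a2 F); split=> //.
  + by exists 1; rewrite mulr1 opprK lE scale0r add0r scale1r.
  + by rewrite comp3_lin /= scale1r scale0r add0r addNr.
  move=> [[x y] z]; rewrite comp3_lin /= => e; exists y.
  have /eqP : lin (x, 0, z - y * w) = 0.
    by rewrite -[RHS]e lE -!mul_mpolyC; ring.
  by rewrite lin_eq0 !xpair_eqE !subr_eq0 mulr1 mulr0 => /andP[/andP[/eqP-> _] /eqP->].
exists 0, (a1 F), (a2 F); split=> //.
+ by exists 1; rewrite mulr1 subr0 lE !scale0r !add0r scale1r.
+ by rewrite comp3_lin /= scale1r !scale0r !add0r.
move=> [[x y] z]; rewrite comp3_lin /= => e; exists z.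
have /eqP : lin (x, y, 0) = 0 by rewrite -[RHS]e lE -!mul_mpolyC; ring.
by rewrite lin_eq0 !xpair_eqE mulr1 !mulr0 => /andP[/andP[/eqP-> /eqP->] _].
Qed.

(** Stands in for unique factorization: the substitution whose kernel is generated by [lin t] kills
    none of the other factors, so it kills the cofactor. *)
Lemma mdvd_prod_lin ts f : uniq ts -> all normal ts ->
  (forall t, t \in ts -> mdvd (lin t) f) -> mdvd (\prod_(t <- ts) lin t) f.
Proof.
elim: ts => [|t ts IH] /=; first by exists f; rewrite big_nil mul1r.
move=> /andP[t_ts uts] /andP[nt nts] H.
have [h fE] : mdvd (\prod_(t <- ts) lin t) f.
  by apply: IH => // t' t'_ts; apply: H; rewrite inE t'_ts orbT.
have [T [kerT injT]] := normal_lin_prime nt.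
have /kerT/eqP : mdvd (lin t) f by apply: H; rewrite mem_head.
rewrite fE rmorphM rmorph_prod mulf_eq0 prodf_seq_eq0 => /orP[/hasP[t' t'_ts /eqP e]|].
  by rewrite -(injT t') ?t'_ts // ?(allP nts) in t_ts.
by move=> /eqP/kerT[h' ->]; exists h'; rewrite big_cons mulrCA mulrA.
Qed.

Lemma prod_lin_neq0 ts : all normal ts -> \prod_(t <- ts) lin t != 0.
Proof.
move=> nts; rewrite prodf_seq_neq0; apply/allP => t /(allP nts)/normal_neq0.
by rewrite lin_eq0.
Qed.

Lemma msize_prod_lin ts : all normal ts ->
  msize (\prod_(t <- ts) lin t) = (size ts).+1.
Proof.
elim: ts => [|t ts IH] /=; first by rewrite big_nil msize1.
move=> /andP[/normal_neq0 nt nts]; rewrite big_cons msizeM ?lin_eq0 ?prod_lin_neq0 //.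
by rewrite msize_lin // IH.
Qed.

End LinearForms.
Arguments normal {F} t.
Arguments lin {F} t.

(** * Invariance of the generators *)

Section Invariance.
Variables (p n : nat) (F : fieldType) (s : seq F).
Hypothesis sP : odd_Fq p n s.
Implicit Types (f g h : {mpoly F[3]}) (t : F * F * F) (K : seq F).
Let two0 := two_neq0 sP.
Local Notation swap := (qact (0 : F) 1 1 0).
Local Notation refl := (qact (1 : F) 0 0 (-1)).

Lemma actE (g : 'M[F]_2) f : act g f = qact (g 0 0) (g 0 1) (g 1 0) (g 1 1) f.
Proof. by []. Qed.

Lemma actD (g : 'M[F]_2) : {morph act g : f h / f + h}. Proof. exact: comp_mpolyD. Qed.
Lemma actB (g : 'M[F]_2) : {morph act g : f h / f - h}. Proof. exact: comp_mpolyB. Qed.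
Lemma actM (g : 'M[F]_2) : {morph act g : f h / f * h}. Proof. exact: qactM. Qed.
Lemma actX (g : 'M[F]_2) k : {morph act g : f / f ^+ k}. Proof. exact: qactX. Qed.
Lemma actZ (g : 'M[F]_2) c : {morph act g : f / c *: f}. Proof. exact: qactZ. Qed.

Lemma qact1 f : qact 1 0 0 1 f = f.
Proof.
rewrite -[RHS]comp3_id; congr (_ \mPo _); apply/val_inj.
by rewrite /= !expr1n !expr0n /= !mulr0 !mul0r !mulr1 !addr0 !scale0r !scale1r ?addr0 ?add0r.
Qed.

Lemma qact_lin a b c d t : qact a b c d (lin t) =
  lin (a ^+ 2 * t.1.1 + a * c * t.1.2 + c ^+ 2 * t.2,
       2 * a * b * t.1.1 + (a * d + b * c) * t.1.2 + 2 * c * d * t.2,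
       b ^+ 2 * t.1.1 + b * d * t.1.2 + d ^+ 2 * t.2).
Proof. by rewrite /qact comp3_lin /lin /= -!mul_mpolyC; ring. Qed.

Lemma qact_Delta a b c d : qact a b c d (Delta F) = (a * d - b * c) ^+ 2 *: Delta F.
Proof.
rewrite /qact /Delta comp_mpolyB rmorphXn rmorphM /= !comp3_var -!mul_mpolyC; ring.
Qed.

Lemma upper_lower_invariant f :
  {in s, forall x, qact 1 x 0 1 f = f} -> {in s, forall x, qact 1 0 x 1 f = f} ->
  sl2_invariant s f.
Proof.
move=> fU fL g [gs]; rewrite det_mx22 actE.
move: (gs 0 0) (gs 0 1) (gs 1 0) (gs 1 1).
move: (g 0 0) (g 0 1) (g 1 0) (g 1 1) => {gs g}.
(* For c nonzero the matrix is the product of the upper shear by (a - 1)/c, the lower shear by c and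
   the upper shear by (d - 1)/c. *)
have H a b c d : a \in s -> c \in s -> d \in s -> c != 0 -> a * d - b * c = 1 ->
    qact a b c d f = f.
  move=> as_ cs ds c0 det1.
  have xs : (a - 1) / c \in s by rewrite !(FqM sP, FqB sP, FqV sP, Fq1 sP).
  have ys : (d - 1) / c \in s by rewrite !(FqM sP, FqB sP, FqV sP, Fq1 sP).
  rewrite -[RHS](fU _ ys) -[in RHS](fL c cs) -[in RHS](fU _ xs) !qactA.
  have -> : b = (a * d - 1) / c by rewrite -det1; field.
  by apply: eq_qact; field.
move=> a b c d as_ bs cs ds det1; have [c0|/H] := eqVneq c 0; last exact.
have d0 : d != 0.
  by apply/eqP => d0; move/eqP: det1; rewrite c0 d0 !mulr0 subrr eq_sym oner_eq0.
(* (a, b; 0, d) is (a + b, b; d, d) times the lower shear by -1, and the first factor has a nonzero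
   lower left entry. *)
have Ns : -1 \in s by rewrite (FqN sP) ?(Fq1 sP).
rewrite -[RHS](fL _ Ns) -[in RHS](H (a + b) b d d) ?(FqD sP) //; last first.
  by rewrite -det1 c0; ring.
by rewrite qactA c0; apply: eq_qact; ring.
Qed.

Lemma swapK f : swap (swap f) = f.
Proof. by rewrite qactA -[RHS]qact1; apply: eq_qact; ring. Qed.

Lemma qact_neq0 f : swap f != 0 -> f != 0.
Proof. by apply: contraNneq => ->; rewrite qact0. Qed.

(** Since [swap] is an involution, the cofactor h satisfies h * swap h = 1, and comparing degrees
    makes it a constant. *)
Lemma mdvd_swap f : f != 0 -> mdvd f (swap f) ->
  exists2 c, c ^+ 2 = 1 & swap f = c *: f.
Proof.
move=> f0 [h fh].
have hh : h * swap h = 1.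
  by apply: (mulfI f0); rewrite mulrA -fh mulr1 -{2}[f]swapK [in RHS]fh qactM.
have /eqP/msize_poly1P[c c0 hc] : msize h = 1%N.
  have h0 : h != 0.
    by apply/eqP => h0; move/eqP: hh; rewrite h0 mul0r eq_sym oner_eq0.
  have h0' : swap h != 0 by apply: qact_neq0; rewrite swapK.
  have := congr1 (fun x => msize x) hh; rewrite /= msizeM // msize1; move: h0 h0'.
  rewrite -!msize_poly_eq0; case: (msize h) => [|[|a]] // _.
  by case: (msize _) => //= b _; rewrite addSn addnS.
exists c; last by rewrite fh hc mulrC mul_mpolyC.
apply/eqP; rewrite -(mpolyC_eq 3); move: hh.
by rewrite hc /qact comp_mpolyC -mpolyCM expr2 => ->; rewrite mpolyC1.
Qed.

(** A lower shear is an upper shear conjugated by [swap], so the sign c enters twice and cancels. *)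
Lemma upper_swap_invariant f : f != 0 ->
  {in s, forall x, qact 1 x 0 1 f = f} -> mdvd f (swap f) -> sl2_invariant s f.
Proof.
move=> f0 fU /mdvd_swap[//|c c2 fc]; apply: upper_lower_invariant => // x xs.
have -> : qact 1 0 x 1 f = swap (qact 1 x 0 1 (swap f)).
  by rewrite !qactA; apply: eq_qact; ring.
by rewrite fc qactZ fU // qactZ fc scalerA -expr2 c2 scale1r.
Qed.

Definition conic (k c : F) : F * F * F := (1, 2 * c, c ^+ 2 - k).
Definition conics K := [seq conic k c | k <- K, c <- s].

Lemma gammaE k : gamma s k = \prod_(c <- s) lin (conic k c).
Proof. by apply: eq_bigr => c _; rewrite /lin scale1r. Qed.

Lemma prod_gammaE K : \prod_(k <- K) gamma s k = \prod_(t <- conics K) lin t.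
Proof. by rewrite big_allpairs_dep; apply: eq_bigr => k _; rewrite gammaE. Qed.

Lemma normal_conics K : all normal (conics K).
Proof. by apply/allP => _ /allpairsP[[k c] [_ _ ->]]; rewrite /normal eqxx. Qed.

Lemma conics_uniq K : uniq K -> uniq (conics K).
Proof.
move=> Ku; apply: allpairs_uniq => //; first exact: Fq_uniq sP.
move=> [k c] [k' c'] _ _ [] /= /(mulfI two0) -> /addrI /oppr_inj ->.
by [].
Qed.

(** The linear factors of each generator as distinct normal triples, the shape that [mdvd_prod_lin]
    requires. *)
Definition Jlin := (0, 0, 1) :: conics [:: 0].
Definition Glin := conics (qnonres s).
Definition Blin := [seq (0, 1, c) | c <- s] ++ conics (qres s).

Lemma JE : JJ s = \prod_(t <- Jlin) lin t.
Proof. by rewrite /JJ big_cons -prod_gammaE big_seq1 /lin !scale0r !add0r scale1r. Qed.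

Lemma GE : Gam s = \prod_(t <- Glin) lin t. Proof. exact: prod_gammaE. Qed.

Lemma betaE : beta s = \prod_(c <- s) lin (0, 1, c).
Proof. by apply: eq_bigr => c _; rewrite /lin scale1r scale0r add0r. Qed.

Lemma BE : BB s = \prod_(t <- Blin) lin t.
Proof. by rewrite /BB big_cat big_map betaE prod_gammaE. Qed.

Lemma Jlin_normal : all normal Jlin.
Proof. by rewrite /= normal_conics /normal !eqxx !orbT. Qed.
Lemma Glin_normal : all normal Glin. Proof. exact: normal_conics. Qed.
Lemma Blin_normal : all normal Blin.
Proof.
rewrite all_cat normal_conics andbT; apply/allP => _ /mapP[c _ ->].
by rewrite /normal !eqxx orbT.
Qed.

Lemma Jlin_uniq : uniq Jlin.
Proof.
rewrite /= conics_uniq // andbT; apply/allpairsP => -[[k c] [_ _ []]] /eqP.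
by rewrite eq_sym oner_eq0.
Qed.
Lemma Glin_uniq : uniq Glin.
Proof. exact/conics_uniq/filter_uniq/(Fq_uniq sP). Qed.
Lemma Blin_uniq : uniq Blin.
Proof.
rewrite cat_uniq map_inj_uniq ?(Fq_uniq sP) => [|c c' []] //=.
rewrite conics_uniq ?andbT ?filter_uniq ?(Fq_uniq sP) //.
apply/hasPn => _ /allpairsP[[k c] [_ _ ->]]; apply/negP => /mapP[c' _ []] /eqP.
by rewrite oner_eq0.
Qed.

(** Rescaling the form multiplies this discriminant by a square, so over F_q its square class
    decides which of J, Gamma and B the form divides. *)
Definition disc t := t.1.2 ^+ 2 - 4 * t.1.1 * t.2.

Lemma mdvd_lin_prod c t ts : c != 0 ->
  (c * t.1.1, c * t.1.2, c * t.2) \in ts -> mdvd (lin t) (\prod_(t' <- ts) lin t').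
Proof.
move=> c0 t_ts; rewrite (perm_big _ (perm_to_rem t_ts)) /= big_cons lin_scale.
by eexists; rewrite -scalerAl scalerAr.
Qed.

(** Completing the square: divided by its first coefficient u, the triple (u, v, w) becomes
    [conic k c] with c = v/(2u) and k = c^2 - w/u. *)
Lemma mdvd_lin_conics K t : t.1.1 \in s -> t.1.2 \in s -> t.1.1 != 0 ->
  (t.1.2 / (2 * t.1.1)) ^+ 2 - t.2 / t.1.1 \in K ->
  mdvd (lin t) (\prod_(k <- K) gamma s k).
Proof.
case: t => [[u v] w] /= us vs u0 Kt; rewrite prod_gammaE.
apply: (@mdvd_lin_prod u^-1); first by rewrite invr_eq0.
apply/allpairsP; exists ((v / (2 * u)) ^+ 2 - w / u, v / (2 * u)); split=> //=.
  by rewrite (FqM sP) // (FqV sP) // (FqM sP) // (Fq_nat sP).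
by congr (_, _, _); field; rewrite ?u0.
Qed.

Lemma disc_conic u v w : u != 0 ->
  (v / (2 * u)) ^+ 2 - w / u = disc (u, v, w) / (2 * u) ^+ 2.
Proof. by move=> u0; rewrite /disc /=; field; rewrite u0. Qed.

Lemma mdvd_lin_J t : t.1.1 \in s -> t.1.2 \in s ->
  t != (0, 0, 0) -> disc t = 0 -> mdvd (lin t) (JJ s).
Proof.
case: t => [[u v] w] /= us vs; have [->|u0 _ dt] := eqVneq u 0.
  rewrite /disc /= mulr0 mul0r subr0 => t0 /eqP; rewrite sqrf_eq0 => /eqP v0.
  have w0 : w != 0 by apply: contraNneq t0 => ->; rewrite v0.
  rewrite JE; apply: (@mdvd_lin_prod w^-1); first by rewrite invr_eq0.
  by rewrite v0 /= !mulr0 mulVf // mem_head.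
apply: mdvdM; suff: mdvd (lin (u, v, w)) (\prod_(k <- [:: 0]) gamma s k).
  by rewrite big_seq1.
apply: mdvd_lin_conics => //=.
by rewrite disc_conic // dt mul0r mem_head.
Qed.

Lemma mdvd_lin_Gam t : t.1.1 \in s -> t.1.2 \in s -> t.2 \in s ->
  disc t \in qnonres s -> mdvd (lin t) (Gam s).
Proof.
case: t => [[u v] w] /= us vs ws; rewrite (mem_qnonres s) => /and3P[ds d0 dN].
have u0 : u != 0.
  apply: contraNneq dN => ->; apply/hasP; exists v => //.
  by rewrite /disc /= mulr0 mul0r subr0.
apply: mdvd_lin_conics => //=; rewrite disc_conic // (mem_qnonres s).
have s2u : 2 * u \in s by rewrite (FqM sP) // (Fq_nat sP).
have u20 : 2 * u != 0 by rewrite mulf_neq0.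
rewrite (FqM sP) ?(FqV sP) ?(FqX sP) //= mulf_neq0 ?invr_eq0 ?expf_neq0 //=.
apply: contra dN => /hasP[x xs /eqP xE]; apply/hasP; exists (x * (2 * u)).
  by rewrite (FqM sP).
by rewrite exprMn xE divfK // expf_neq0.
Qed.

Lemma mdvd_lin_B t : t.1.1 \in s -> t.1.2 \in s -> t.2 \in s ->
  disc t \in qres s -> mdvd (lin t) (BB s).
Proof.
case: t => [[u v] w] /= us vs ws /(mem_qres sP)[x xs [x0 dx]].
have [u0|u0] := eqVneq u 0.
  have v0 : v != 0.
    apply: contraNneq x0 => v0; move: dx; rewrite /disc /= u0 v0 mulr0 mul0r expr0n subr0.
    by move/esym/eqP; rewrite sqrf_eq0.
  rewrite BE; apply: (@mdvd_lin_prod v^-1); first by rewrite invr_eq0.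
  rewrite mem_cat; apply/orP; left; apply/mapP; exists (v^-1 * w).
    by rewrite (FqM sP) // (FqV sP).
  by rewrite u0 mulr0 mulVf.
apply: mdvdM; apply: mdvd_lin_conics => //=; rewrite disc_conic // dx.
have u20 : 2 * u != 0 by rewrite mulf_neq0.
apply/(mem_qres sP); exists (x / (2 * u)).
  by rewrite (FqM sP) // (FqV sP) // (FqM sP) // (Fq_nat sP).
by rewrite expr_div_n mulf_neq0 // invr_eq0.
Qed.

Lemma disc_conicE k c : disc (conic k c) = k * 2 ^+ 2.
Proof. by rewrite /disc /=; ring. Qed.

Lemma qres_mul_sqr k x : x \in s -> x != 0 -> (k \in qres s) -> k * x ^+ 2 \in qres s.
Proof.
move=> xs x0 /(mem_qres sP)[y ys [y0 ->]]; apply/(mem_qres sP); exists (y * x).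
  exact: (FqM sP).
by rewrite exprMn mulf_neq0.
Qed.

Lemma qnonres_mul_sqr k x :
  x \in s -> x != 0 -> (k \in qnonres s) -> k * x ^+ 2 \in qnonres s.
Proof.
move=> xs x0; rewrite !(mem_qnonres s) => /and3P[ks k0 kN].
rewrite (FqM sP) ?(FqX sP) // mulf_neq0 ?expf_neq0 //=.
apply: contra kN => /hasP[y ys /eqP yE]; apply/hasP; exists (y / x).
  by rewrite (FqM sP) // (FqV sP).
by rewrite expr_div_n yE mulfK ?expf_neq0.
Qed.

Definition rational t := [&& t.1.1 \in s, t.1.2 \in s & t.2 \in s].

Lemma conics_rational K t : {subset K <= s} -> t \in conics K -> rational t.
Proof.
move=> Ks /allpairsP[[k c] [/= /Ks ks cs ->]].
by rewrite /rational /= (Fq1 sP) (FqB sP) ?(FqX sP) // (FqM sP) // (Fq_nat sP).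
Qed.

Lemma JlinP t : t \in Jlin -> [/\ rational t, t != (0, 0, 0) & disc t = 0].
Proof.
move=> tJ; split; last 1 [idtac] || idtac.
- move: tJ; rewrite inE => /orP[/eqP->|]; first by rewrite /rational /= (Fq0 sP) (Fq1 sP).
  by apply: conics_rational => x; rewrite inE => /eqP ->; exact: (Fq0 sP).
- exact/normal_neq0/(allP Jlin_normal).
move: tJ; rewrite inE => /orP[/eqP->|]; first by rewrite /disc /=; ring.
by case/allpairsP=> -[k c] [/= + _ ->]; rewrite inE => /eqP->; rewrite disc_conicE mul0r.
Qed.

Lemma GlinP t : t \in Glin -> rational t /\ disc t \in qnonres s.
Proof.
move=> tG; split; first by apply: conics_rational tG => x; rewrite mem_filter => /andP[].
case/allpairsP: tG => -[k c] [/= kN cs ->]; rewrite disc_conicE.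
by apply: qnonres_mul_sqr => //; exact: (Fq_nat sP).
Qed.

Lemma BlinP t : t \in Blin -> rational t /\ disc t \in qres s.
Proof.
rewrite mem_cat => /orP[/mapP[c cs ->]|tB].
  rewrite /rational /= (Fq0 sP) (Fq1 sP) cs; split=> //.
  apply/(mem_qres sP); exists 1; first exact: (Fq1 sP).
  by rewrite oner_eq0 /disc /=; split=> //; ring.
split; first by apply: conics_rational tB => x; rewrite mem_filter => /andP[].
case/allpairsP: tB => -[k c] [/= kN cs ->]; rewrite disc_conicE.
by apply: qres_mul_sqr => //; exact: (Fq_nat sP).
Qed.

Lemma swap_lin t : swap (lin t) = lin (t.2, t.1.2, t.1.1).
Proof. by rewrite qact_lin; congr (lin (_, _, _)); ring. Qed.

Lemma disc_swap t : disc (t.2, t.1.2, t.1.1) = disc t.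
Proof. by rewrite /disc /=; ring. Qed.

(* Since [swap] is an involution, it suffices that each swapped factor divides
   the product. *)
Lemma swap_prod_lin ts : uniq ts -> all normal ts ->
  (forall t, t \in ts -> mdvd (lin (t.2, t.1.2, t.1.1)) (\prod_(t' <- ts) lin t')) ->
  mdvd (\prod_(t <- ts) lin t) (swap (\prod_(t <- ts) lin t)).
Proof.
move=> tsu tsn H; apply: mdvd_prod_lin => // t /H[h ->].
exists (swap h); rewrite qactM swap_lin.
by case: t.
Qed.

Lemma upper_gamma k x : x \in s -> qact 1 x 0 1 (gamma s k) = gamma s k.
Proof.
move=> xs; rewrite gammaE qact_prod.
rewrite -[RHS](@big_Fq_reindex _ _ _ _ sP _ _ _ (fun c => c + x)) /=.
- apply: eq_bigr => c _; rewrite qact_lin /conic /=.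
  by congr (lin (_, _, _)); ring.
- by move=> c c' _ _ /addIr.
by move=> c cs; exact: (FqD sP).
Qed.

Lemma upper_prod_gamma K x : x \in s ->
  qact 1 x 0 1 (\prod_(k <- K) gamma s k) = \prod_(k <- K) gamma s k.
Proof.
move=> xs; rewrite qact_prod; apply: eq_bigr => k _.
exact: upper_gamma.
Qed.

Lemma upper_beta x : x \in s -> qact 1 x 0 1 (beta s) = beta s.
Proof.
move=> xs; rewrite betaE qact_prod.
rewrite -[RHS](@big_Fq_reindex _ _ _ _ sP _ _ _ (fun c => c + x)) /=.
- apply: eq_bigr => c _; rewrite qact_lin /=.
  by congr (lin (_, _, _)); ring.
- by move=> c c' _ _ /addIr.
by move=> c cs; exact: (FqD sP).
Qed.

Lemma J_invariant : sl2_invariant s (JJ s).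
Proof.
apply: upper_swap_invariant; first by rewrite JE prod_lin_neq0 // Jlin_normal.
  move=> x xs; rewrite /JJ qactM upper_gamma //.
  by rewrite qact_a0 expr1n scale1r.
rewrite JE; apply: swap_prod_lin; rewrite ?Jlin_uniq ?Jlin_normal //.
move=> t /JlinP[/and3P[u v w] t0 dt]; rewrite -JE.
apply: mdvd_lin_J => //=; last by rewrite disc_swap.
by apply: contraNneq t0; case: t {u v w dt} => [[u v] w] [-> -> ->].
Qed.

Lemma Gam_invariant : sl2_invariant s (Gam s).
Proof.
apply: upper_swap_invariant; first by rewrite GE prod_lin_neq0 // Glin_normal.
  by move=> x xs; rewrite upper_prod_gamma.
rewrite GE; apply: swap_prod_lin; rewrite ?Glin_uniq ?Glin_normal //.
move=> t /GlinP[/and3P[u v w] dt]; rewrite -GE.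
by apply: mdvd_lin_Gam => //=; rewrite disc_swap.
Qed.

Lemma B_invariant : sl2_invariant s (BB s).
Proof.
apply: upper_swap_invariant; first by rewrite BE prod_lin_neq0 // Blin_normal.
  by move=> x xs; rewrite /BB qactM upper_prod_gamma // upper_beta.
rewrite BE; apply: swap_prod_lin; rewrite ?Blin_uniq ?Blin_normal //.
move=> t /BlinP[/and3P[u v w] dt]; rewrite -BE.
by apply: mdvd_lin_B => //=; rewrite disc_swap.
Qed.

Lemma Delta_invariant : sl2_invariant s (Delta F).
Proof. by move=> g [_ dg]; rewrite actE qact_Delta -det_mx22 dg expr1n scale1r. Qed.

Lemma refl_lin t : refl (lin t) = lin (t.1.1, - t.1.2, t.2).
Proof. by rewrite qact_lin; congr (lin (_, _, _)); ring. Qed.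

Lemma refl_gamma k : refl (gamma s k) = gamma s k.
Proof.
rewrite gammaE qact_prod.
rewrite -[RHS](@big_Fq_reindex _ _ _ _ sP _ _ _ (-%R)) /=.
- apply: eq_bigr => c _; rewrite refl_lin /conic /=.
  by congr (lin (_, _, _)); ring.
- by move=> c c' _ _ /oppr_inj.
by move=> c cs; exact: (FqN sP).
Qed.

Lemma refl_prod_gamma K : refl (\prod_(k <- K) gamma s k) = \prod_(k <- K) gamma s k.
Proof.
by rewrite qact_prod; apply: eq_bigr => k _; exact: refl_gamma.
Qed.

Lemma refl_beta : refl (beta s) = - beta s.
Proof.
rewrite betaE qact_prod.
rewrite -[in RHS](@big_Fq_reindex _ _ _ _ sP _ _ _ (-%R)) /=; last 2 first.
- by move=> c c' _ _ /oppr_inj.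
- by move=> c cs; exact: (FqN sP).
transitivity (\prod_(c <- s) (-1 * lin (0, 1, - c))).
  apply: eq_bigr => c _; rewrite refl_lin /=.
  by rewrite -mpolyC1 -mpolyCN mul_mpolyC -lin_scale /=; congr (lin (_, _, _)); ring.
rewrite big_split /= big_const_seq count_predT (Fq_size sP) iter_mulr_1.
by rewrite -signr_odd (q_odd sP) mulN1r.
Qed.

Lemma refl_J : refl (JJ s) = JJ s.
Proof. by rewrite /JJ qactM refl_gamma qact_a0 sqrrN expr1n scale1r. Qed.
Lemma refl_Gam : refl (Gam s) = Gam s. Proof. exact: refl_prod_gamma. Qed.
Lemma refl_B : refl (BB s) = - BB s.
Proof.
by rewrite /BB qactM refl_prod_gamma refl_beta mulNr.
Qed.
Lemma refl_Delta : refl (Delta F) = Delta F.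
Proof. by rewrite qact_Delta mulr0 subr0 mul1r sqrrN expr1n scale1r. Qed.

End Invariance.

(** * Divisibility of invariants by J and B *)

Section Division.
Variables (p n : nat) (F : fieldType) (s : seq F).
Hypothesis sP : odd_Fq p n s.
Implicit Types (f g h : {mpoly F[3]}) (t : F * F * F).
Local Notation refl := (qact (1 : F) 0 0 (-1)).

Lemma reflE f : refl f = f \mPo [tuple a0 F; - a1 F; a2 F].
Proof.
congr (_ \mPo _); apply/val_inj; rewrite /= sqrrN !expr1n !expr0n /=.
by rewrite !mulr0 !mul0r !mul1r !addr0 !scale0r !scale1r !addr0 !add0r scaleN1r.
Qed.

Lemma qact_invariant f a b c d : sl2_invariant s f ->
  a \in s -> b \in s -> c \in s -> d \in s -> a * d - b * c = 1 ->
  qact a b c d f = f.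
Proof.
move=> fI as_ bs cs ds det1.
pose M : 'M[F]_2 := \matrix_(i, j) if i == 0 then (if j == 0 then a else b)
                                   else (if j == 0 then c else d).
have MP : inSL2 s M.
  split; last by rewrite det_mx22 !mxE.
  by move=> i j; rewrite mxE; do 2!case: ifP.
by rewrite -[RHS](fI M MP) actE !mxE.
Qed.

Lemma mdvd_lin_orbit f u t a b c d e : sl2_invariant s f ->
  a \in s -> b \in s -> c \in s -> d \in s -> a * d - b * c = 1 ->
  qact a b c d u = e *: lin t -> mdvd u f -> mdvd (lin t) f.
Proof.
move=> fI as_ bs cs ds det1 ut [h fE].
rewrite -(qact_invariant fI as_ bs cs ds det1) fE qactM ut -scalerAl scalerAr.
by eexists.
Qed.

Lemma invariant_quotient g h : g != 0 ->
  sl2_invariant s g -> sl2_invariant s (g * h) -> sl2_invariant s h.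
Proof.
move=> g0 gI ghI M MP; apply: (mulfI g0); rewrite -[RHS](ghI M MP).
by rewrite actM gI.
Qed.

Lemma J_neq0 : JJ s != 0.
Proof. by rewrite JE prod_lin_neq0 // Jlin_normal. Qed.
Lemma Gam_neq0 : Gam s != 0.
Proof. by rewrite GE prod_lin_neq0 // Glin_normal. Qed.
Lemma B_neq0 : BB s != 0.
Proof. by rewrite BE prod_lin_neq0 // Blin_normal. Qed.

Lemma J_divides f : sl2_invariant s f -> f \mPo [tuple 0; a1 F; a2 F] = 0 ->
  exists2 h, sl2_invariant s h & f = JJ s * h.
Proof.
move=> fI f0; suff [h fE] : mdvd (JJ s) f.
  exists h => //; apply: invariant_quotient J_neq0 (J_invariant sP) _.
  by rewrite -fE.
have a0f : mdvd (a0 F) f.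
  rewrite -[f]subr0 -f0 -{1}[f]comp3_id; apply: mdvd_comp3_sub.
  - by exists 1; rewrite subr0 mulr1.
  - by exists 0; rewrite subrr mulr0.
  - by exists 0; rewrite subrr mulr0.
have a0E : a0 F = lin (0, 0, 1) by rewrite /lin !scale0r !add0r scale1r.
rewrite JE; apply: mdvd_prod_lin; rewrite ?(Jlin_uniq sP) ?Jlin_normal //.
move=> t; rewrite inE => /orP[/eqP->|]; first by rewrite -a0E.
case/allpairsP=> -[k c] [/= + cs ->]; rewrite inE => /eqP->.
(* The target is (X + c Y)^2 and a0 is Y^2, so the second row is (1, c); the first row (0, -1)
   completes it to determinant 1. *)
apply: (@mdvd_lin_orbit f (a0 F) _ 0 (-1) 1 c 1) => //;
  rewrite ?(FqN sP) ?(Fq1 sP) ?(Fq0 sP) //; first by rewrite mul0r sub0r mulNr opprK mulr1.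
by rewrite a0E qact_lin scale1r /conic /=; congr (lin (_, _, _)); ring.
Qed.

Lemma odd_B_divides f : sl2_invariant s f -> refl f = - f ->
  exists h, [/\ sl2_invariant s h, refl h = h & f = BB s * h].
Proof.
move=> fI fN; suff [h fE] : mdvd (BB s) f.
  exists h; split=> //; first by apply: invariant_quotient B_neq0 (B_invariant sP) _; rewrite -fE.
  apply: (mulfI B_neq0); apply: oppr_inj.
  by rewrite -mulNr -(refl_B sP) -qactM -fE fN.
have a1f : mdvd (a1 F) f.
  (* The reflection has no effect at a1 = 0, so f equals -f there, and 2 is invertible. *)
  have f0 : f \mPo [tuple a0 F; 0; a2 F] = 0.
    have := congr1 (comp_mpoly [tuple a0 F; 0; a2 F]) fN.
    rewrite reflE comp3A comp_mpolyN /= comp_mpolyN !comp3_var oppr0.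
    move/eqP; rewrite -addr_eq0 -mulr2n -scaler_nat scaler_eq0.
    by rewrite (negPf (two_neq0 sP)) => /eqP.
  rewrite -[f]subr0 -f0 -{1}[f]comp3_id; apply: mdvd_comp3_sub.
  - by exists 0; rewrite subrr mulr0.
  - by exists 1; rewrite subr0 mulr1.
  - by exists 0; rewrite subrr mulr0.
have a1E : a1 F = lin (0, 1, 0) by rewrite /lin !scale0r add0r addr0 scale1r.
rewrite BE; apply: mdvd_prod_lin; rewrite ?(Blin_uniq sP) ?Blin_normal //.
move=> t; rewrite mem_cat => /orP[/mapP[c cs ->]|].
  apply: (@mdvd_lin_orbit f (a1 F) _ 1 c 0 1 1) => //;
    rewrite ?(Fq1 sP) ?(Fq0 sP) //; first by rewrite mulr0 subr0 mulr1.
  by rewrite a1E qact_lin scale1r /=; congr (lin (_, _, _)); ring.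
case/allpairsP=> -[k c] [/= /(mem_qres sP)[x xs [x0 ->]] cs ->].
have mus : - (2 * x)^-1 \in s.
  by rewrite (FqN sP) // (FqV sP) // (FqM sP) // (Fq_nat sP).
(* For k = x^2 the conic splits as (X + (c + x) Y)(X + (c - x) Y), and a1 is XY: the two factors are
   the rows. Scaling the second row by -1/(2x) makes the determinant 1. *)
apply: (@mdvd_lin_orbit f (a1 F) _ 1 (c + x) (- (2 * x)^-1)
          (- (2 * x)^-1 * (c - x)) (- (2 * x)^-1)) => //.
- exact: (Fq1 sP).
- exact: (FqD sP).
- by rewrite (FqM sP) // (FqB sP).
- by field; rewrite x0 (two_neq0 sP).
rewrite a1E qact_lin -lin_scale /conic /=.
by congr (lin (_, _, _)); ring.
Qed.

End Division.

(** * Invariants even in a1 *)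

Section EvenInvariants.
Variables (p n : nat) (F : fieldType) (s : seq F).
Hypothesis sP : odd_Fq p n s.
Implicit Types (f g h u v w x : {mpoly F[3]}) (t : F * F * F).
Local Notation refl := (qact (1 : F) 0 0 (-1)).
Local Notation q := (p ^ n)%N.
Local Notation r := ((p ^ n).-1./2).

(** Total degree, with value 0 at the zero polynomial, so that subadditivity over products holds
    without nonvanishing conditions. *)
Definition tdeg k (f : {mpoly F[k]}) := (msize f).-1.

Lemma leq_msize_tdeg k (f : {mpoly F[k]}) : (msize f <= (tdeg f).+1)%N.
Proof. by rewrite /tdeg; case: (msize f). Qed.

Lemma tdegM k (f g : {mpoly F[k]}) : (tdeg (f * g) <= tdeg f + tdeg g)%N.
Proof.
have [->|f0] := eqVneq f 0; first by rewrite mul0r /tdeg msize0.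
have [->|g0] := eqVneq g 0; first by rewrite mulr0 /tdeg msize0.
move: (f0) (g0); rewrite /tdeg msizeM // -!msize_poly_eq0.
by case: (msize f) (msize g) => // a [] // b; rewrite addSn addnS.
Qed.

Lemma tdegX k (f : {mpoly F[k]}) i : (tdeg (f ^+ i) <= i * tdeg f)%N.
Proof.
elim: i => [|i IH]; first by rewrite expr0 /tdeg msize1.
by rewrite exprS mulSn (leq_trans (tdegM _ _)) // leq_add2l.
Qed.

Lemma msize_comp3 f u v w : (tdeg u <= 1)%N -> (tdeg v <= 1)%N -> (tdeg w <= 1)%N ->
  (msize (f \mPo [tuple u; v; w]) <= msize f)%N.
Proof.
move=> du dv dw; rewrite comp3E big_seq.
elim/big_ind: _ => [|x y xf yf|m /msize_mdeg_lt mf]; first by rewrite msize0.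
  by apply: leq_trans (msizeD_le _ _) _; rewrite geq_max xf.
apply: leq_trans (msizeZ_le _ _) _; apply: leq_trans (leq_msize_tdeg _) _.
apply: leq_ltn_trans mf; rewrite mdegE big_ord3.
have h (z : {mpoly F[3]}) i : (tdeg z <= 1)%N -> (tdeg (z ^+ i) <= i)%N.
  by move=> dz; apply: leq_trans (tdegX _ _) _; rewrite -[leqRHS]muln1 leq_mul2l dz orbT.
apply: leq_trans (tdegM _ _) _; apply: leq_add; last exact: h.
by apply: leq_trans (tdegM _ _) _; apply: leq_add; exact: h.
Qed.

Lemma tdeg_var (i : 'I_3) : tdeg ('X_i : {mpoly F[3]}) = 1%N.
Proof. by rewrite /tdeg msizeX mdeg1. Qed.

Definition gens3 : 3.-tuple {mpoly F[3]} := [tuple Delta F; JJ s; Gam s].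
Definition inA f := exists P : {mpoly F[3]}, f = P \mPo gens3.

Lemma inA_D f g : inA f -> inA g -> inA (f + g).
Proof. by move=> [P ->] [Q ->]; exists (P + Q); rewrite comp_mpolyD. Qed.
Lemma inA_M f g : inA f -> inA g -> inA (f * g).
Proof. by move=> [P ->] [Q ->]; exists (P * Q); rewrite rmorphM. Qed.
Lemma inA_Z c f : inA f -> inA (c *: f).
Proof. by move=> [P ->]; exists (c *: P); rewrite comp_mpolyZ. Qed.
Lemma inA_0 : inA 0. Proof. by exists 0; rewrite comp_mpoly0. Qed.
Lemma inA_X f i : inA f -> inA (f ^+ i).
Proof. by move=> [P ->]; exists (P ^+ i); rewrite rmorphXn. Qed.
Lemma inA_Delta : inA (Delta F). Proof. by exists (a0 F); rewrite comp3_var. Qed.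
Lemma inA_J : inA (JJ s). Proof. by exists (a1 F); rewrite comp3_var. Qed.
Lemma inA_Gam : inA (Gam s). Proof. by exists (a2 F); rewrite comp3_var. Qed.

Lemma inA_invariant f : inA f -> sl2_invariant s f.
Proof.
move=> [P ->] g gs; rewrite /gens3 {1}/act comp3A -!/(act g _).
by rewrite (Delta_invariant gs) (J_invariant sP gs) (Gam_invariant sP gs).
Qed.

Lemma inA_refl f : inA f -> refl f = f.
Proof.
move=> [P ->]; rewrite /gens3 {1}/qact comp3A -!/(qact _ _ _ _ _).
by rewrite refl_Delta (refl_J sP) (refl_Gam sP).
Qed.

(** [rho] is reduction modulo a0, whose ideal is preserved by the upper triangular matrices. Modulo
    a0, the matrix (1, b; 0, 1) acts as [shear b] and diag(a, 1/a) as [dilate a]; [neg] is the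
    reflection. *)
Local Notation rho := (comp_mpoly [tuple 0; a1 F; a2 F]).
Local Notation neg := (comp_mpoly [tuple a0 F; - a1 F; a2 F]).
Local Notation shear b := (comp_mpoly [tuple a0 F; a1 F; a2 F + (2 * b) *: a1 F]).
Local Notation dilate a := (comp_mpoly [tuple a0 F; a1 F; (a ^+ 2) *: a2 F]).

Definition Nlin : seq (F * F * F) := [seq (1, 2 * c, 0) | c <- s].
Definition NN : {mpoly F[3]} := \prod_(t <- Nlin) lin t.

Lemma NE : NN = \prod_(c <- s) lin (1, 2 * c, 0). Proof. exact: big_map. Qed.

Lemma Nlin_normal : all normal Nlin.
Proof. by apply/allP => _ /mapP[c _ ->]; rewrite /normal eqxx. Qed.

Lemma Nlin_uniq : uniq Nlin.
Proof.
rewrite map_inj_uniq; first exact: Fq_uniq sP.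
by move=> c c' [] /(mulfI (two_neq0 sP)).
Qed.

Lemma msize_N : msize NN = q.+1.
Proof. by rewrite msize_prod_lin ?Nlin_normal // size_map (Fq_size sP). Qed.

Lemma N_neq0 : NN != 0. Proof. by rewrite prod_lin_neq0 // Nlin_normal. Qed.

Lemma rho_gamma k : rho (gamma s k) = NN.
Proof.
rewrite gammaE rmorph_prod NE; apply: eq_bigr => c _.
by rewrite /= comp3_lin /lin /= scaler0 scale0r.
Qed.
Lemma rho_N : rho NN = NN.
Proof. by rewrite -[in LHS](rho_gamma 0) comp3A !comp3_var comp_mpoly0 rho_gamma. Qed.
Lemma rho_prod_gamma K : rho (\prod_(k <- K) gamma s k) = NN ^+ size K.
Proof.
rewrite rmorph_prod (eq_bigr (fun=> NN)) => [|k _]; last exact: rho_gamma.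
by rewrite big_const_seq count_predT iter_mulr_1.
Qed.
Lemma rho_Gam : rho (Gam s) = NN ^+ r.
Proof. by rewrite rho_prod_gamma (size_qnonres sP). Qed.
Lemma rho_Delta : rho (Delta F) = a1 F ^+ 2.
Proof. by rewrite /Delta comp_mpolyB rmorphXn rmorphM /= !comp3_var mul0r subr0. Qed.
Lemma rho_B : rho (BB s) = a1 F ^+ q * NN ^+ r.
Proof.
rewrite /BB rmorphM /= rho_prod_gamma (size_qres sP); congr (_ * _).
rewrite rmorph_prod (eq_bigr (fun=> a1 F)) => [|c _].
  by rewrite big_const_seq count_predT iter_mulr_1 (Fq_size sP).
by rewrite /= comp_mpolyD comp_mpolyZ !comp3_var scaler0 addr0.
Qed.

Lemma neg_N : neg NN = NN.
Proof.
rewrite NE rmorph_prod -[RHS](@big_Fq_reindex _ _ _ _ sP _ _ _ (-%R)) /=.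
- apply: eq_bigr => c _; rewrite comp3_lin /lin /=.
  by rewrite scalerN mulrN scaleNr.
- by move=> c c' _ _ /oppr_inj.
by move=> c cs; exact: (FqN sP).
Qed.

Lemma shear_N b : b \in s -> shear b NN = NN.
Proof.
move=> bs; rewrite NE rmorph_prod -[RHS](@big_Fq_reindex _ _ _ _ sP _ _ _ (fun c => c + b)) /=.
- apply: eq_bigr => c _; rewrite comp3_lin /lin /= -!mul_mpolyC; ring.
- by move=> c c' _ _ /addIr.
by move=> c cs; exact: (FqD sP).
Qed.

(** Each of the q factors contributes a^2 after c is rescaled, and a^(2q) = a^2. *)
Lemma dilate_N a : a \in s -> a != 0 -> dilate a NN = a ^+ 2 *: NN.
Proof.
move=> as_ a0; have e : a ^+ 2 = (a ^+ 2) ^+ size s.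
  rewrite (Fq_size sP); have := FqX sP 2 as_.
  by rewrite (mem_Fq sP) => /eqP ->.
rewrite [X in _ = X *: _]e NE rmorph_prod -[in RHS](@big_Fq_reindex _ _ _ _ sP _ _ _ (fun c => c / a ^+ 2)) /=.
- rewrite -[_ ^+ size s]iter_mulr_1 -(count_predT s) -big_const_seq -scaler_prod.
  apply: eq_bigr => c _; rewrite comp3_lin -lin_scale /lin /=.
  by rewrite scalerA; congr (_ *: _ + _ *: _ + _ *: _); field.
- by move=> c c' _ _; apply: mulIf; rewrite invr_eq0 expf_neq0.
by move=> c cs; rewrite (FqM sP) ?(FqV sP) ?(FqX sP).
Qed.

(** The bound d keeps the subtracted element from raising the degree; dividing by J then makes the
    outer induction decrease. *)
Definition lifts d x := exists g, [/\ inA g, (msize g <= d)%N & rho g = x].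

Lemma lifts0 d : lifts d 0.
Proof. by exists 0; split; [exact: inA_0 | rewrite msize0 | rewrite comp_mpoly0]. Qed.
Lemma liftsD d x y : lifts d x -> lifts d y -> lifts d (x + y).
Proof.
move=> [g [gA gd <-]] [h [hA hd <-]]; exists (g + h); split; first exact: inA_D.
  by apply: leq_trans (msizeD_le _ _) _; rewrite geq_max gd.
by rewrite comp_mpolyD.
Qed.
Lemma liftsZ d c x : lifts d x -> lifts d (c *: x).
Proof.
move=> [g [gA gd <-]]; exists (c *: g); split; first exact: inA_Z.
  exact: leq_trans (msizeZ_le _ _) gd.
by rewrite comp_mpolyZ.
Qed.

Lemma tdeg_Gam : tdeg (Gam s) = (q * r)%N.
Proof.
rewrite /tdeg GE msize_prod_lin ?Glin_normal //= size_allpairs.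
by rewrite (size_qnonres sP) (Fq_size sP) mulnC.
Qed.

Lemma tdeg_Delta : (tdeg (Delta F) <= 2)%N.
Proof.
rewrite /tdeg -ltnS prednK; last first.
  rewrite lt0n msize_poly_eq0; apply/eqP => D0.
  move/eqP: rho_Delta; rewrite D0 comp_mpoly0 eq_sym expf_eq0 /=.
  by rewrite -msize_poly_eq0 msizeX mdeg1.
apply: leq_trans (msizeD_le _ _) _; rewrite msizeN geq_max.
apply/andP; split; apply: leq_trans (leq_msize_tdeg _) _; rewrite ltnS.
  by apply: leq_trans (tdegX _ _) _; rewrite tdeg_var.
by apply: leq_trans (tdegM _ _) _; rewrite !tdeg_var.
Qed.

Lemma lifts_monomial d i j : (2 * i + q * (r * j) < d)%N ->
  lifts d (a1 F ^+ (2 * i) * NN ^+ (r * j)).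
Proof.
move=> ijd; exists (Delta F ^+ i * Gam s ^+ j); split.
- exact/inA_M/inA_X/inA_Gam/inA_X/inA_Delta.
- apply: leq_trans (leq_msize_tdeg _) _; apply: leq_trans ijd; rewrite ltnS.
  apply: leq_trans (tdegM _ _) _; apply: leq_add; apply: leq_trans (tdegX _ _) _.
    by rewrite mulnC leq_mul2r tdeg_Delta orbT.
  by rewrite tdeg_Gam mulnC mulnA.
by rewrite rmorphM !rmorphXn /= rho_Delta rho_Gam -!exprM.
Qed.

(** At a0 = a2 = 0 only powers of a1 remain. Writing the value as half the sum of itself and its
    image under a1 -> -a1 cancels the odd powers term by term; the even ones come from Delta. *)
Lemma lifts_even h d j : neg h = h -> (msize h + q * (r * j) <= d)%N ->
  lifts d ((h \mPo [tuple 0; a1 F; 0]) * NN ^+ (r * j)).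
Proof.
move=> hE hd; set u := h \mPo _.
have uE : u = h \mPo [tuple 0; - a1 F; 0].
  by rewrite /u -{1}hE comp3A comp_mpolyN !comp3_var.
have -> : u = 2^-1 *: (u + u).
  by rewrite -mulr2n -scaler_nat scalerA mulVf ?scale1r // (two_neq0 sP).
rewrite -scalerAl; apply: liftsZ; rewrite {2}uE /u !comp3E -big_split mulr_suml.
rewrite big_seq; elim/big_ind: _ => [|x y|m /msize_mdeg_lt mh].
- exact: lifts0.
- exact: liftsD.
rewrite /= -scalerDr -scalerAl; apply: liftsZ.
rewrite !expr0n; case: eqP => [_|_]; last by rewrite !mul0r addr0 mul0r; exact: lifts0.
case: eqP => [_|_]; last by rewrite !mulr0 addr0 mul0r; exact: lifts0.
rewrite !mul1r !mulr1; set k := m o1.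
rewrite exprNn -signr_odd -[in odd _](odd_double_half k) oddD odd_double addbF oddb.
case E : (odd k); first by rewrite expr1 mulN1r subrr mul0r; exact: lifts0.
rewrite expr0 mul1r -mulr2n -scaler_nat -scalerAl; apply: liftsZ.
have kE : k = (2 * k./2)%N by rewrite mul2n -[LHS](odd_double_half k) E.
rewrite kE; apply: lifts_monomial; apply: leq_trans hd; rewrite -kE.
rewrite -addSn leq_add2r; apply: leq_trans mh; rewrite ltnS mdegE.
by rewrite (bigD1 o1) //= leq_addr.
Qed.

(* A shear-invariant [h] takes the same value [u] at all the zeros
   [a2 = - 2 c a1] of [NN], so [NN] divides [h - u], and the quotient is
   shear-invariant of smaller degree. *)
Lemma lifts_borel m h e d : (msize h <= m)%N ->
  rho h = h -> neg h = h -> {in s, forall b, shear b h = h} ->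
  {in s, forall a, a != 0 -> a ^+ (2 * e) *: dilate a h = h} ->
  (msize h + q * e <= d)%N -> lifts d (h * NN ^+ e).
Proof.
elim: m h e => [|m IH] h e hm hr hn hs hd hed.
  by move: hm; rewrite leqn0 msize_poly_eq0 => /eqP ->; rewrite mul0r; exact: lifts0.
pose u := h \mPo [tuple 0; a1 F; 0].
have uE : u = h \mPo [tuple a0 F; a1 F; 0].
  by rewrite -{1}hr comp3A comp_mpoly0 !comp3_var.
have ur : rho u = u by rewrite comp3A !comp_mpoly0 !comp3_var.
have un : neg u = u.
  by rewrite comp3A !comp_mpoly0 !comp3_var -{1}hn comp3A comp_mpolyN !comp3_var opprK.
have us b : shear b u = u by rewrite comp3A !comp_mpoly0 !comp3_var.
have ud a : dilate a u = u by rewrite comp3A !comp_mpoly0 !comp3_var.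
have usz : (msize u <= msize h)%N.
  by apply: msize_comp3; rewrite ?tdeg_var // /tdeg msize0.
have [h' hE] : mdvd NN (h - u).
  apply: mdvd_prod_lin; rewrite ?Nlin_uniq ?Nlin_normal // => _ /mapP[c cs ->].
  rewrite uE -{1}(hs c cs); apply: mdvd_comp3_sub.
  - by exists 0; rewrite subrr mulr0.
  - by exists 0; rewrite subrr mulr0.
  - by exists 1; rewrite subr0 mulr1 /lin /= scale1r scale0r addr0.
(* [e] counts the factors N split off so far. Each one lowers the degree of the cofactor by q, which
   preserves the bound, and raises its required torus exponent by 2. *)
have -> : h * NN ^+ e = u * NN ^+ e + h' * NN ^+ e.+1.
  by rewrite exprS mulrCA mulrA -hE -mulrDl addrC subrK.
apply: liftsD; last first.
  have [->|h'0] := eqVneq h' 0; first by rewrite mul0r; exact: lifts0.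
  have h'sz : (q + msize h' <= msize h)%N.
    have := msizeM N_neq0 h'0; rewrite msize_N addSn /= => <-; rewrite -hE.
    by apply: leq_trans (msizeD_le _ _) _; rewrite msizeN geq_max leqnn.
  apply: IH.
  - rewrite -ltnS; apply: leq_trans hm; apply: leq_trans h'sz.
    by rewrite -add1n leq_add2r; apply: leq_trans (q_gt2 sP).
  - by apply: (mulfI N_neq0); rewrite -{1}rho_N -rmorphM -hE /= comp_mpolyB hr ur.
  - by apply: (mulfI N_neq0); rewrite -{1}neg_N -rmorphM -hE /= comp_mpolyB hn un.
  - move=> b bs; apply: (mulfI N_neq0).
    by rewrite -{1}(shear_N bs) -rmorphM -hE /= comp_mpolyB (hs b bs) (us b).
  - move=> a as_ a0; apply: (mulfI N_neq0); rewrite -hE mulnS exprD.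
    rewrite (mulrC (a ^+ 2)) -scalerA -!scalerAr scalerAl -(dilate_N as_ a0).
    rewrite -rmorphM -hE /= comp_mpolyB scalerBr hd // ud; congr (_ - _).
    by rewrite /u -{2}(hd a as_ a0) comp_mpolyZ comp3A comp_mpolyZ !comp3_var scaler0.
  - by apply: leq_trans hed; rewrite mulnS addnA leq_add2r addnC.
have [->|u0] := eqVneq u 0; first by rewrite mul0r; exact: lifts0.
(* The torus fixes a1, hence [u], so its condition reads a^(2e) = 1; therefore N^e is a power of the
   image of Gamma. *)
have /dvdnP[j eE] : (r %| e)%N.
  apply: (dvdn_exponent sP) => a as_ a0.
  have : a ^+ (2 * e) *: u = 1 *: u.
    rewrite scale1r -{2}[u]/(h \mPo _) -(hd a as_ a0).
    by rewrite comp_mpolyZ comp3A comp_mpolyZ !comp3_var scaler0.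
  move/eqP; rewrite -subr_eq0 -scalerBl scaler_eq0 (negPf u0) orbF subr_eq0.
  by move/eqP.
by move: hed; rewrite eE (mulnC j); exact: lifts_even.
Qed.

Lemma even_invariant_inA f : sl2_invariant s f -> refl f = f -> inA f.
Proof.
have [m] := ubnP (msize f); elim: m f => // m IH f fm fI fe.
have [g [gA gf gE]] : lifts (msize f) (rho f).
  rewrite -[rho f]mulr1 -(expr0 NN).
  apply: (@lifts_borel (msize f)) => //.
  - by apply: msize_comp3; rewrite ?tdeg_var // /tdeg msize0.
  - by rewrite comp3A !comp_mpoly0 !comp3_var.
  - rewrite comp3A !comp_mpoly0 !comp3_var -[in RHS]fe reflE.
    by rewrite comp3A comp_mpolyN !comp3_var.
  - move=> b bs; rewrite comp3A !comp_mpoly0 !comp3_var.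
    have fb : qact 1 b 0 1 f = f.
      by rewrite (qact_invariant fI) ?(Fq1 sP) ?(Fq0 sP) // mulr0 subr0 mulr1.
    rewrite -[in RHS]fb /qact comp3A !comp_mpolyD !comp_mpolyZ !comp3_var.
    by congr (_ \mPo _); apply/val_inj; rewrite /= -!mul_mpolyC; congr [:: _; _; _]; ring.
  - move=> a as_ a0; rewrite muln0 expr0 scale1r.
    rewrite comp3A !comp_mpoly0 !comp3_var.
    have fb : qact a 0 0 a^-1 f = f.
      by rewrite (qact_invariant fI) ?(FqV sP) ?(Fq0 sP) // mulr0 subr0 mulfV.
    rewrite -[in RHS]fb /qact comp3A !comp_mpolyD !comp_mpolyZ !comp3_var.
    congr (_ \mPo _); apply/val_inj; rewrite /= mulfV // expr0n /=.
    by rewrite !mulr0 !mul0r !scale0r !scaler0 !addr0 !add0r scale1r.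
  by rewrite muln0 addn0; apply: msize_comp3; rewrite ?tdeg_var // /tdeg msize0.
have fgI : sl2_invariant s (f - g).
  by move=> M Ms; rewrite actB fI // (inA_invariant gA).
have [h hI fgE] : exists2 h, sl2_invariant s h & f - g = JJ s * h.
  by apply: (J_divides sP fgI); rewrite comp_mpolyB gE subrr.
rewrite -[f](subrK g) fgE; apply: (inA_D _ gA); apply: (inA_M inA_J).
have [->|h0] := eqVneq h 0; first exact: inA_0.
apply: IH => //; last first.
  apply: (mulfI (J_neq0 s)); rewrite -{1}(refl_J sP) -qactM -fgE qactB fe.
  by rewrite (inA_refl gA).
have J1 : (2 <= msize (JJ s))%N by rewrite JE msize_prod_lin ?Jlin_normal.
have fgm : (msize (f - g) <= m)%N.
  apply: leq_trans (msizeD_le _ _) _; rewrite msizeN geq_max.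
  by rewrite -ltnS fm /= -ltnS; apply: leq_ltn_trans gf fm.
apply: leq_trans fgm; rewrite fgE msizeM ?J_neq0 //.
by case: (msize (JJ s)) J1 => [|[|a]] // _; rewrite !addSn /= ltnS leq_addl.
Qed.

End EvenInvariants.

(** * Lead monomials *)

Section LeadMonomials.
Import Order.TTheory.
Variable F : fieldType.
Implicit Types (f g h : {mpoly F[3]}) (m : 'X_{1..3}).

Definition mnm3 (x y z : nat) : 'X_{1..3} := Multinom [tuple x; y; z].

Lemma mnm3E : ((forall x y z, mnm3 x y z o0 = x) * (forall x y z, mnm3 x y z o1 = y)
  * (forall x y z, mnm3 x y z o2 = z))%type.
Proof. by split; [split|] => x y z; rewrite (mnm_nth 0%N) /= ?o1E ?o2E. Qed.

Lemma ord3P (i : 'I_3) : [\/ i = o0, i = o1 | i = o2].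
Proof.
case: i => [[|[|[|//]]] lti]; [constructor 1 | constructor 2 | constructor 3];
  by apply/val_inj; rewrite /= ?o1E ?o2E.
Qed.

Lemma mnm3P m m' : m o0 = m' o0 -> m o1 = m' o1 -> m o2 = m' o2 -> m = m'.
Proof.
by move=> e0 e1 e2; apply/mnmP => i; case: (ord3P i) => ->.
Qed.

Lemma mdeg3 m : mdeg m = (m o0 + m o1 + m o2)%N.
Proof. by rewrite mdegE big_ord3. Qed.

Lemma mpolyX3 m : 'X_[m] = a0 F ^+ m o0 * a1 F ^+ m o1 * a2 F ^+ m o2.
Proof. by rewrite mpolyXE_id big_ord3. Qed.

Lemma ltmc3 m m' : mdeg m = mdeg m' ->
  (m < m')%O = (m o0 < m' o0)%N || (m o0 == m' o0) && (m o1 < m' o1)%N.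
Proof.
move=> e; apply/(ltmcP e)/idP => [[i]|].
  have [->|->|->] := ord3P i; first by move=> _ ->.
    by move=> H ->; rewrite (H o0) ?o1E // ltnn eqxx.
  move=> H; rewrite (H o0) ?(H o1) ?o1E ?o2E // !ltnn !eqxx /=.
  by move: e; rewrite !mdeg3 (H o0) ?(H o1) ?o1E ?o2E // => /addnI ->; rewrite ltnn.
case/orP => [lt0|/andP[/eqP e0 lt1]]; first by exists o0.
exists o1 => // j; rewrite o1E ltnS leqn0 => /eqP j0.
by have -> : j = o0 by apply/val_inj.
Qed.

(* The substitution [X0 -> X2^2, X1 -> X0 X2, X2 -> X0 X1] is injective on
   monomials and carries the grevlex order to the degree-lexicographic order
   underlying [mlead]: [Phi m] has degree [2 mdeg m] and starts with
   [mdeg m - m o0] and [mdeg m - m o0 - m o1]. *)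
Definition phi : 3.-tuple {mpoly F[3]} := [tuple a2 F ^+ 2; a0 F * a2 F; a0 F * a1 F].
Definition Phi m := mnm3 (m o1 + m o2) (m o2) (2 * m o0 + m o1).

Lemma Phi0 : Phi 0%MM = 0%MM.
Proof.
by apply: mnm3P; rewrite !mnm3E !mnm0E.
Qed.

Lemma PhiD m m' : Phi (m + m')%MM = (Phi m + Phi m')%MM.
Proof.
by apply: mnm3P; rewrite !(mnmDE, mnm3E); lia.
Qed.

Lemma Phi_inj : injective Phi.
Proof.
move=> m m' e; have := congr1 (fun x : 'X_{1..3} => (x o0, x o1, x o2)) e.
rewrite /Phi !mnm3E => -[h0 h1 h2].
by apply: mnm3P; lia.
Qed.

Lemma grevlex_Phi m m' : grevlex_lt m m' = (Phi m < Phi m')%O.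
Proof.
have mdP m1 : mdeg (Phi m1) = (mdeg m1).*2.
  by rewrite !mdeg3 !mnm3E; lia.
rewrite /grevlex_lt; case: (ltngtP (mdeg m) (mdeg m')) => [lt|gt|e] /=.
- by rewrite lt_mdeg_ltmc // !mdP ltn_double.
- apply/esym/negbTE; rewrite -leNgt; apply: ltW; apply: lt_mdeg_ltmc.
  by rewrite !mdP ltn_double.
rewrite ltmc3 ?mdP ?e // !mnm3E; move: e; rewrite !mdeg3.
by move=> e; apply/idP/idP; lia.
Qed.

Lemma phiX m : 'X_[m] \mPo phi = 'X_[Phi m] :> {mpoly F[3]}.
Proof.
rewrite mpolyX3 [in RHS]mpolyX3 !mnm3E.
rewrite !rmorphM !rmorphXn /= !comp3_var !exprMn !exprD expr0; ring.
Qed.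

Lemma phiE f : f \mPo phi = \sum_(m <- msupp f) f@_m *: 'X_[Phi m].
Proof. by rewrite comp_mpolyEX; apply: eq_bigr => m _; rewrite phiX. Qed.

Lemma phi_eq0 f : (f \mPo phi == 0) = (f == 0).
Proof.
apply/eqP/eqP => [f0|->]; last by rewrite comp_mpoly0.
apply/mpolyP => m; rewrite mcoeff0; apply/eqP/negPn/negP => fm.
have ms : m \in msupp f by rewrite mcoeff_msupp.
move/negP: fm; apply; apply/eqP; rewrite -[RHS](mcoeff0 F (Phi m)) -f0 phiE.
rewrite raddf_sum (bigD1_seq m) ?msupp_uniq //= mcoeffZ mcoeffX eqxx mulr1.
rewrite big1 ?addr0 // => m' m'm; rewrite mcoeffZ mcoeffX (inj_eq Phi_inj).
by rewrite (negPf m'm) mulr0.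
Qed.

(** Distinct monomials have distinct images, so nothing cancels, and the order is preserved; the
    initial value 0 of the fold is the least monomial. *)
Lemma lmon_phi f : Phi (lmon f) = mlead (f \mPo phi).
Proof.
rewrite phiE mlead_sum; last first.
  have e : {in msupp f, (fun m => mlead (f@_m *: 'X_[Phi m])) =1 Phi}.
    by move=> m ms; rewrite mleadZ ?mleadXm // -mcoeff_msupp.
  by rewrite filter_predT ((eq_in_map _ _ _).1 e) map_inj_uniq ?msupp_uniq //; exact: Phi_inj.
rewrite /lmon big_seq (eq_bigr Phi) => [|m ms]; last first.
  by rewrite mleadZ ?mleadXm // -mcoeff_msupp.
rewrite -big_seq; elim: (msupp f) => [|m r IH] /=; first by rewrite big_nil Phi0.
by rewrite big_cons -IH grevlex_Phi; case: ltP.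
Qed.

(** The largest of the lead monomials occurs in a single summand, so it cannot cancel. *)
Lemma dominant_sum (I : eqType) (r : seq I) (c : I -> F) (G : I -> {mpoly F[3]}) :
  r != [::] -> uniq r -> {in r, forall i, c i != 0 /\ G i != 0} ->
  {in r &, injective (fun i => mlead (G i))} ->
  exists i, [/\ i \in r, \sum_(i <- r) c i *: G i != 0
    & mlead (\sum_(i <- r) c i *: G i) = mlead (G i)].
Proof.
move=> r0 ru cG Ginj.
have [i ir imax] : exists2 i, i \in r & {in r, forall j, (mlead (G j) <= mlead (G i))%O}.
  elim: r r0 {ru cG Ginj} => // i [|i' r] IH _.
    by exists i; rewrite ?mem_head // => j; rewrite inE => /eqP->.
  have [//|k kr kmax] := IH.
  have [ik|ki] := leP (mlead (G i)) (mlead (G k)).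
    by exists k => [|j]; rewrite inE ?kr ?orbT // => /orP[/eqP->|/kmax].
  exists i; rewrite ?mem_head // => j; rewrite inE => /orP[/eqP->//|/kmax jk].
  exact: le_trans jk (ltW ki).
set S := \sum_(i <- r) _.
have Si : S@_(mlead (G i)) != 0.
  rewrite /S raddf_sum (bigD1_seq i) //= mcoeffZ big_seq_cond big1 ?addr0.
    by have [ci Gi] := cG i ir; rewrite mulf_neq0 // mleadc_eq0.
  move=> j /andP[jr ji]; rewrite mcoeffZ mcoeff_gt_mlead ?mulr0 //.
  rewrite lt_neqAle imax // andbT; apply: contraNneq ji => e; apply/eqP.
  exact: Ginj.
exists i; split=> //; first by apply: contraNneq Si => ->; rewrite mcoeff0.
apply/le_anti/andP; split; last by apply: msupp_le_mlead; rewrite mcoeff_msupp.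
apply: le_trans (mlead_sum_le _ _ _) _; rewrite big_seq; apply/joinsP_seq => j jr _.
exact: le_trans (mleadZ_le _ _) (imax j jr).
Qed.

End LeadMonomials.

(** * Structure of the invariant ring *)

Section Structure.
Import Order.TTheory.
Variables (p n : nat) (F : fieldType) (s : seq F).
Hypothesis sP : odd_Fq p n s.
Implicit Types (f g h : {mpoly F[3]}) (t : F * F * F).
Local Notation refl := (qact (1 : F) 0 0 (-1)).
Local Notation q := (p ^ n)%N.
Local Notation r := ((p ^ n).-1./2).
Local Notation phi := (phi F).
Local Notation gens3 := (gens3 s).

Lemma invariant_decomposition f : sl2_invariant s f ->
  exists P0 P1 : {mpoly F[3]}, f = (P0 \mPo gens3) + BB s * (P1 \mPo gens3).
Proof.
move=> fI.
have rI : sl2_invariant s (refl f).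
  move=> g [gs]; rewrite det_mx22 => det1; rewrite actE.
  (* This is the conjugate of g by diag(1, -1), which is again in the group. *)
  have {2}<- : qact (g 0 0) (- g 0 1) (- g 1 0) (g 1 1) f = f.
    by apply: (qact_invariant fI) => //; rewrite ?(FqN sP) // mulrNN.
  by rewrite !qactA; apply: eq_qact; ring.
have rr : refl (refl f) = f by rewrite qactA -[RHS]qact1; apply: eq_qact; ring.
have [P0 P0E] : inA s (2^-1 *: (f + refl f)).
  apply: (even_invariant_inA sP); last by rewrite qactZ qactD rr addrC.
  by move=> g gs; rewrite actZ actD (fI g gs) (rI g gs).
have [h [hI he hE]] : exists h, [/\ sl2_invariant s h, refl h = h &
    2^-1 *: (f - refl f) = BB s * h].
  apply: (odd_B_divides sP); last by rewrite qactZ qactB rr -scalerN opprB.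
  by move=> g gs; rewrite actZ actB (fI g gs) (rI g gs).
have [P1 P1E] := even_invariant_inA sP hI he.
exists P0, P1; rewrite -P0E -P1E -hE -scalerDr addrACA subrr addr0.
by rewrite -mulr2n -scaler_nat scalerA mulVf ?scale1r // (two_neq0 sP).
Qed.

(** * Lead monomials of the generators and of their products *)

Lemma lin_phi t : lin t \mPo phi =
  t.1.1 *: 'X_[mnm3 1 1 0] + t.1.2 *: 'X_[mnm3 1 0 1] + t.2 *: 'X_[mnm3 0 0 2].
Proof. by rewrite comp3_lin !mpolyX3 !mnm3E !expr0 !expr1 !mulr1 !mul1r. Qed.

Lemma lt_mnm3 x y z x' y' z' : (x + y + z = x' + y' + z')%N ->
  (mnm3 x y z < mnm3 x' y' z')%O = (x < x')%N || (x == x') && (y < y')%N.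
Proof. by move=> e; rewrite ltmc3 !(mdeg3, mnm3E). Qed.

Lemma mlead_lin1 v w : mlead (lin (1, v, w) \mPo phi) = mnm3 1 1 0.
Proof.
have lt z (m : 'X_{1..3}) : (m < mnm3 1 1 0)%O ->
    (mlead (z *: 'X_[m] : {mpoly F[3]}) < mnm3 1 1 0)%O.
  by move=> lt; apply: le_lt_trans (mleadZ_le _ _) _; rewrite mleadXm.
have e : mlead ('X_[mnm3 1 1 0] + v *: 'X_[mnm3 1 0 1] : {mpoly F[3]}) = mnm3 1 1 0.
  by rewrite mleadDl mleadXm // lt // lt_mnm3.
by rewrite lin_phi scale1r /= mleadDl e // lt // lt_mnm3.
Qed.

Lemma mlead_lin01 w : mlead (lin (0, 1, w) \mPo phi) = mnm3 1 0 1.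
Proof.
rewrite lin_phi /= scale0r add0r scale1r mleadDl mleadXm //.
by apply: le_lt_trans (mleadZ_le _ _) _; rewrite mleadXm lt_mnm3.
Qed.

Lemma mlead_prod_const (T : eqType) (l : seq T) (G : T -> {mpoly F[3]}) m i :
  {in l, forall x, G x != 0 /\ mlead (G x) = m} ->
  mlead (\prod_(x <- l) G x) i = (size l * m i)%N.
Proof.
move=> H; rewrite mlead_prod => [|x xl _]; last by case: (H x xl).
rewrite mnm_sumE big_seq (eq_bigr (fun=> m i)) => [|x xl]; last by case: (H x xl) => _ ->.
by rewrite -big_seq big_const_seq count_predT iter_addn_0 mulnC.
Qed.

Lemma lin_phi_neq0 t : normal t -> lin t \mPo phi != 0.
Proof. by move/normal_neq0; rewrite phi_eq0 lin_eq0. Qed.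

Lemma mlead_conics K i :
  mlead ((\prod_(k <- K) gamma s k) \mPo phi) i = (size K * q * mnm3 1 1 0 i)%N.
Proof.
rewrite prod_gammaE rmorph_prod (@mlead_prod_const _ _ _ (mnm3 1 1 0)).
  by rewrite size_allpairs (Fq_size sP).
move=> t tK; split; first exact/lin_phi_neq0/(allP (normal_conics _ _) _ tK).
by case/allpairsP: tK => -[k c] [_ _ ->]; exact: mlead_lin1.
Qed.

Lemma phi_neq0 f : f != 0 -> f \mPo phi != 0. Proof. by rewrite phi_eq0. Qed.

Lemma mlead_Delta : mlead (Delta F \mPo phi) = mnm3 2 0 2.
Proof.
rewrite comp_mpolyB rmorphXn rmorphM /= !comp3_var.
have -> : (a0 F * a2 F) ^+ 2 = 'X_[mnm3 2 0 2].
  by rewrite mpolyX3 !mnm3E expr0 mulr1 exprMn.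
have -> : a2 F ^+ 2 * (a0 F * a1 F) = 'X_[mnm3 1 1 2].
  by rewrite mpolyX3 !mnm3E !expr1 mulrC.
by rewrite mleadDl mleadXm // mleadN mleadXm lt_mnm3.
Qed.

Lemma mlead_Gam : mlead (Gam s \mPo phi) = mnm3 (q * r) (q * r) 0.
Proof.
by apply: mnm3P; rewrite mlead_conics (size_qnonres sP) !mnm3E ?muln0 ?muln1 // mulnC.
Qed.

Lemma prod_gamma_neq0 K : \prod_(k <- K) gamma s k != 0.
Proof. by rewrite prod_gammaE prod_lin_neq0 // normal_conics. Qed.

Lemma mlead_J : mlead (JJ s \mPo phi) = mnm3 q q 2.
Proof.
have e i : mlead (gamma s 0 \mPo phi) i = (q * mnm3 1 1 0 i)%N.
  by have := mlead_conics [:: 0] i; rewrite big_seq1 mul1n.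
have g0 : gamma s 0 != 0 by have := prod_gamma_neq0 [:: 0]; rewrite big_seq1.
have a2E : a2 F ^+ 2 = 'X_[mnm3 0 0 2] by rewrite mpolyX3 !mnm3E !expr0 !mul1r.
rewrite /JJ rmorphM /= comp3_var mleadM ?phi_neq0 ?a2E //; last first.
  by rewrite -msize_poly_eq0 msizeX.
by rewrite mleadXm; apply: mnm3P; rewrite mnmDE e !mnm3E ?muln0 ?muln1.
Qed.

Lemma mlead_B : mlead (BB s \mPo phi) = mnm3 (q + q * r) (q * r) q.
Proof.
have e i : mlead (beta s \mPo phi) i = (q * mnm3 1 0 1 i)%N.
  rewrite betaE rmorph_prod (@mlead_prod_const _ _ _ (mnm3 1 0 1)) ?(Fq_size sP) //.
  move=> c _; split; last exact: mlead_lin01.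
  by apply: lin_phi_neq0; rewrite /normal !eqxx orbT.
have b0 : beta s != 0.
  by apply: contraNneq (B_neq0 s) => b0; rewrite /BB b0 mul0r.
rewrite /BB rmorphM /= mleadM ?phi_neq0 ?prod_gamma_neq0 //.
apply: mnm3P; rewrite mnmDE e mlead_conics (size_qres sP) !mnm3E ?muln0 ?muln1 //;
  by rewrite ?(mulnC r) ?addn0.
Qed.

Lemma Delta_neq0 : Delta F != 0.
Proof.
apply/eqP => D0; have := mlead_Delta; rewrite D0 comp_mpoly0 mlead0.
by move/(congr1 (fun m : 'X_{1..3} => m o0)); rewrite mnm3E mnm0E.
Qed.

Definition gen_monomial (mb : 'X_{1..3} * bool) : {mpoly F[3]} :=
  Delta F ^+ mb.1 o0 * JJ s ^+ mb.1 o1 * Gam s ^+ mb.1 o2 * BB s ^+ mb.2.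

Lemma gen_monomial_neq0 mb : gen_monomial mb != 0.
Proof.
by rewrite !mulf_neq0 ?expf_neq0 ?Delta_neq0 ?J_neq0 ?Gam_neq0 ?B_neq0.
Qed.

Lemma mlead_gen_monomial mb : mlead (gen_monomial mb \mPo phi) =
  (mlead (Delta F \mPo phi) *+ mb.1 o0 + mlead (JJ s \mPo phi) *+ mb.1 o1
   + mlead (Gam s \mPo phi) *+ mb.1 o2 + mlead (BB s \mPo phi) *+ mb.2)%MM.
Proof.
rewrite /gen_monomial.
move: (Delta F) (JJ s) (Gam s) (BB s) Delta_neq0 (J_neq0 s) (Gam_neq0 s) (B_neq0 s).
move=> D J G B D0 J0 G0 B0; rewrite !rmorphM !rmorphXn /=.
by rewrite !mleadM ?mulf_neq0 ?expf_neq0 ?phi_neq0 // !mleadX ?phi_neq0.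
Qed.

(* The exponents are read off the coordinates of the lead monomial:
   the parity of the last one gives the exponent of [B], the difference
   of the first two that of [Delta]. *)
Lemma mlead_gen_monomial_inj : injective (fun mb => mlead (gen_monomial mb \mPo phi)).
Proof.
move=> [m b] [m' b'] e.
have := congr1 (fun x : 'X_{1..3} => (x o0, x o1, x o2)) e.
rewrite /= !mlead_gen_monomial mlead_Delta mlead_J mlead_Gam mlead_B.
rewrite !mnmDE !mulmnE !mnm3E /= => -[ex ey ez].
have qo := q_odd sP; have rq := r_gt0 sP; have q0 : (0 < q)%N := ltnW (ltnW (q_gt2 sP)).
have eb : b = b'.
  move/(congr1 odd): ez; rewrite !mul0n !addn0 !oddD !oddM qo /=.
  by rewrite !addbF !addbb !oddb.
rewrite -{b'}eb in e ex ey ez *.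
have e0 : m o0 = m' o0 by move: ex ey; case: (b) => /=; rewrite ?muln1 ?muln0 ?mul0n; lia.
have e1 : m o1 = m' o1 by move: ez; rewrite e0; lia.
have e2 : m o2 = m' o2.
  move: ey; rewrite e0 e1 => /addIn /addnI /eqP.
  by rewrite eqn_mul2l muln_eq0 (gtn_eqF q0) (gtn_eqF rq) /= => /eqP.
by congr (_, _); apply: mnm3P.
Qed.

Lemma gen_combination_lead (P0 P1 : {mpoly F[3]}) : (P0, P1) != (0, 0) ->
  let f := (P0 \mPo gens3) + BB s * (P1 \mPo gens3) in
  f != 0 /\ exists mb, mlead (f \mPo phi) = mlead (gen_monomial mb \mPo phi).
Proof.
move=> P01 f; pose sel b := if b then P1 else P0 : {mpoly F[3]}.
(* Both parts form one family indexed by (m, b), which also excludes cancellation between them. *)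
pose l := [seq (m, b) | b <- [:: false; true], m <- msupp (sel b)].
have lP mb : (mb \in l) = (mb.1 \in msupp (sel mb.2)).
  apply/allpairsPdep/idP => [[b [m [_ mP ->]]] //|mP].
  by case: mb mP => m b mP; exists b, m; split=> //; rewrite !inE; case: b {mP}.
have fE : f \mPo phi =
    \sum_(mb <- l) (sel mb.2)@_mb.1 *: (gen_monomial mb \mPo phi).
  rewrite big_allpairs_dep !big_cons big_nil /= addr0 /f comp_mpolyD.
  rewrite rmorphM /= (comp3E _ _ _ P0) (comp3E _ _ _ P1) !raddf_sum mulr_sumr /=; congr (_ + _); apply: eq_bigr => m _.
    by rewrite comp_mpolyZ /gen_monomial /= expr0 mulr1.
  by rewrite comp_mpolyZ -scalerAr -rmorphM /gen_monomial /= expr1 mulrC.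
have [||||mb [_ f0 fl]] := @dominant_sum F _ l (fun mb => (sel mb.2)@_mb.1)
    (fun mb => gen_monomial mb \mPo phi).
- apply: contraNneq P01 => l0; rewrite xpair_eqE.
  have H b : sel b = 0.
    apply/eqP; rewrite -msupp_eq0; case E : (msupp _) => [//|m ms].
    by have := lP (m, b); rewrite l0 /= E mem_head.
  by rewrite (H false : P0 = 0) (H true : P1 = 0) !eqxx.
- by apply: allpairs_uniq_dep => // -[b m] [b' m'] _ _ /= [-> ->].
- by move=> mb; rewrite lP mcoeff_msupp => ->; rewrite phi_neq0 // gen_monomial_neq0.
- by move=> mb mb' _ _; exact: mlead_gen_monomial_inj.
by rewrite -phi_eq0 fE f0; split=> //; exists mb.
Qed.

Lemma gen_combination_eq0 (P0 P1 : {mpoly F[3]}) :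
  (P0 \mPo gens3) + BB s * (P1 \mPo gens3) = 0 -> P0 = 0 /\ P1 = 0.
Proof.
move=> e; have [[-> ->] //|] := eqVneq (P0, P1) (0, 0).
by move/gen_combination_lead => [/eqP].
Qed.

Lemma SAGBI_generators :
  is_SAGBI (sl2_invariant s) [:: Delta F; JJ s; Gam s; BB s].
Proof.
split=> [x|f fI f0].
  rewrite !inE => /or4P[] /eqP->.
  - exact: Delta_invariant.
  - exact: J_invariant sP.
  - exact: Gam_invariant sP.
  - exact: B_invariant sP.
have [P0 [P1 fE]] := invariant_decomposition fI.
have /gen_combination_lead[_ [[m b]]] : (P0, P1) != (0, 0).
  by apply: contraNneq f0 => -[P00 P10]; rewrite fE P00 P10 !comp_mpoly0 mulr0 addr0.
rewrite -fE mlead_gen_monomial -!lmon_phi /= => e.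
have {e} -> : lmon f = (lmon (Delta F) *+ m o0 + lmon (JJ s) *+ m o1
    + lmon (Gam s) *+ m o2 + lmon (BB s) *+ b)%MM.
  have PhiM x k : Phi (x *+ k)%MM = (Phi x *+ k)%MM.
    by elim: k => [|k IH]; rewrite ?mulm0n ?Phi0 // !mulmS PhiD IH.
  by apply: Phi_inj; rewrite e !PhiD !PhiM.
exists [:: m o0; m o1; m o2; nat_of_bool b]; split=> //.
by rewrite !big_ord_recl big_ord0 /= mulr1 !mpolyXD !mpolyXn !mulrA.
Qed.

(** Modulo a0, B becomes a1^q N^r, Delta becomes a1^2 and Gamma becomes N^r, so B^2 and Delta^q
    Gamma^2 agree there and J divides their difference. As B enters squared, the quotient is even
    under the reflection and is a polynomial in Delta, J and Gamma. *)
Lemma B_relation : exists R : {mpoly F[3]},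
  BB s ^+ 2 = Delta F ^+ q * Gam s ^+ 2 + JJ s * (R \mPo gens3).
Proof.
set f := BB s ^+ 2 - Delta F ^+ q * Gam s ^+ 2.
have fI : sl2_invariant s f.
  move=> g gs; rewrite actB actM !actX.
  by rewrite (B_invariant sP gs) (Delta_invariant gs) (Gam_invariant sP gs).
have f0 : f \mPo [tuple 0; a1 F; a2 F] = 0.
  have E (T : 3.-tuple {mpoly F[3]}) (b d g : {mpoly F[3]}) :
      (b ^+ 2 - d ^+ q * g ^+ 2) \mPo T = (b \mPo T) ^+ 2 - (d \mPo T) ^+ q * (g \mPo T) ^+ 2.
    by rewrite comp_mpolyB rmorphXn rmorphM !rmorphXn.
  rewrite /f E (rho_B sP) rho_Delta (rho_Gam sP).
  by rewrite exprMn -!exprM mulnC subrr.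
have [h hI fE] := J_divides sP fI f0.
have he : refl h = h.
  apply: (mulfI (J_neq0 s)); rewrite -{1}(refl_J sP) -qactM -fE.
  by rewrite qactB qactM !qactX (refl_B sP) refl_Delta (refl_Gam sP) sqrrN.
have [R RE] := even_invariant_inA sP hI he.
by exists R; rewrite -RE -fE addrC subrK.
Qed.

(** * Presentation of the ring by the single relation *)

Local Notation gens := [tuple Delta F; JJ s; Gam s; BB s].
Let x0 : {mpoly F[4]} := 'X_(inord 0).
Let x1 : {mpoly F[4]} := 'X_(inord 1).
Let x2 : {mpoly F[4]} := 'X_(inord 2).
Let x3 : {mpoly F[4]} := 'X_(inord 3).
Local Notation widen3 P := (P \mPo [tuple x0; x1; x2]).

Lemma comp_gens : [/\ x0 \mPo gens = Delta F, x1 \mPo gens = JJ s,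
  x2 \mPo gens = Gam s & x3 \mPo gens = BB s].
Proof. by split; rewrite comp_mpolyXU inordK. Qed.

Lemma widen3_gens (P : {mpoly F[3]}) : widen3 P \mPo gens = P \mPo gens3.
Proof. by rewrite comp3A; have [-> -> ->] := comp_gens. Qed.

(** Division with remainder by [relpoly], which is monic of degree 2 in x3: the reducible
    polynomials contain 1 and are closed under linear combinations and multiplication by each
    variable. *)
Lemma relation_reduction (R : {mpoly F[3]}) (P : {mpoly F[4]}) :
  exists Q P0 P1, P = Q * relpoly q R + widen3 P0 + x3 * widen3 P1.
Proof.
have cM (a b : {mpoly F[3]}) : widen3 (a * b) = widen3 a * widen3 b by exact: rmorphM.
pose red P := exists Q P0 P1, P = Q * relpoly q R + widen3 P0 + x3 * widen3 P1.
have redD P' P'' : red P' -> red P'' -> red (P' + P'').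
  move=> [Q' [P0' [P1' ->]]] [Q'' [P0'' [P1'' ->]]].
  exists (Q' + Q''), (P0' + P0''), (P1' + P1''); rewrite !comp_mpolyD; ring.
have redZ c P' : red P' -> red (c *: P').
  move=> [Q' [P0' [P1' ->]]]; exists (c *: Q'), (c *: P0'), (c *: P1').
  by rewrite !comp_mpolyZ -!mul_mpolyC; ring.
have redV v x P' : v \mPo [tuple x0; x1; x2] = x -> red P' -> red (x * P').
  move=> <- [Q' [P0' [P1' ->]]]; exists ((v \mPo [tuple x0; x1; x2]) * Q'), (v * P0'), (v * P1').
  rewrite !cM; move: (widen3 v) (widen3 P0') (widen3 P1') (relpoly q R) => a b c d; ring.
have red3 P' : red P' -> red (x3 * P').
  move=> [Q' [P0' [P1' ->]]].
  (* Here x3^2 is replaced by [relpoly] plus x0^q x2^2 + x1 R, and the latter sum is free of x3. *)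
  exists (x3 * Q' + widen3 P1'), ((a0 F ^+ q * a2 F ^+ 2 + a1 F * R) * P1'), P0'.
  rewrite cM comp_mpolyD !cM !rmorphXn /= !comp3_var /relpoly -/x0 -/x1 -/x2 -/x3.
  move: (widen3 P0') (widen3 P1') (widen3 R) => a b c; ring.
have redX x k P' : (forall P'', red P'' -> red (x * P'')) -> red P' -> red (x ^+ k * P').
  by move=> H rP; elim: k => [|k IH]; rewrite ?expr0 ?mul1r // exprS -mulrA; exact: H.
elim/mpolyind: P => [|c m P _ _ IH].
  by exists 0, 0, 0; rewrite !comp_mpoly0 mul0r mulr0 !addr0.
apply: redD IH; apply: redZ.
have -> : 'X_[m] = x0 ^+ m (inord 0) * (x1 ^+ m (inord 1) * (x2 ^+ m (inord 2) *
    (x3 ^+ m (inord 3) * 1))) :> {mpoly F[4]}.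
  have i0 : inord 0 = ord0 :> 'I_4 by apply/val_inj; rewrite /= inordK.
  have i1 : inord 1 = lift ord0 ord0 :> 'I_4 by apply/val_inj; rewrite /= inordK.
  have i2 : inord 2 = lift ord0 (lift ord0 ord0) :> 'I_4.
    by apply/val_inj; rewrite /= inordK.
  have i3 : inord 3 = lift ord0 (lift ord0 (lift ord0 ord0)) :> 'I_4.
    by apply/val_inj; rewrite /= inordK.
  by rewrite mpolyXE_id !big_ord_recl big_ord0 /x0 /x1 /x2 /x3 i0 i1 i2 i3.
apply: (redX) => [P'|]; first by apply: (redV (a0 F)); rewrite comp3_var.
apply: (redX) => [P'|]; first by apply: (redV (a1 F)); rewrite comp3_var.
apply: (redX) => [P'|]; first by apply: (redV (a2 F)); rewrite comp3_var.
apply: (redX) => //; exists 0, 1, 0.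
by rewrite comp_mpoly0 comp_mpoly1 mul0r mulr0 addr0 add0r.
Qed.

(** The remainder of P modulo [relpoly] also evaluates to 0, so both its coefficients vanish by
    [gen_combination_eq0]. *)
Lemma relation_generates (R : {mpoly F[3]}) (P : {mpoly F[4]}) :
  BB s ^+ 2 = Delta F ^+ q * Gam s ^+ 2 + JJ s * (R \mPo gens3) ->
  P \mPo gens = 0 -> exists Q, P = Q * relpoly q R.
Proof.
have [c0 c1 c2 c3] := comp_gens; move=> BR.
have R0 : relpoly q R \mPo gens = 0.
  rewrite /relpoly -/x0 -/x1 -/x2 -/x3 !comp_mpolyB.
  rewrite (rmorphM _ (x0 ^+ q)) (rmorphM _ x1) !rmorphXn /=.
  by rewrite widen3_gens c0 c1 c2 c3 BR; ring.
have [Q [P0 [P1 ->]]] := relation_reduction R P.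
rewrite !comp_mpolyD !rmorphM /= R0 mulr0 add0r c3 !widen3_gens.
by move/gen_combination_eq0 => [-> ->]; exists Q; rewrite !comp_mpoly0 mulr0 !addr0.
Qed.

Lemma invariants_generated f : sl2_invariant s f ->
  exists P : {mpoly F[4]}, f = P \mPo gens.
Proof.
move=> /invariant_decomposition[P0 [P1 ->]]; have [_ _ _ c3] := comp_gens.
by exists (widen3 P0 + x3 * widen3 P1); rewrite comp_mpolyD rmorphM /= !widen3_gens c3.
Qed.

End Structure.

Theorem theorem3p4 (p n : nat) (F : fieldType) (s : seq F) :
  prime p -> (2 < p)%N -> (0 < n)%N -> p \in [pchar F] -> is_Fq (p ^ n) s ->
  let q := (p ^ n)%N in
  let gens : 4.-tuple {mpoly F[3]} := [tuple Delta F; JJ s; Gam s; BB s] in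
  (* the four generators are invariant *)
  (forall i, sl2_invariant s (tnth gens i)) /\
  (* they generate the invariant ring as an F-algebra *)
  (forall f, sl2_invariant s f ->
     exists P : {mpoly F[4]}, f = P \mPo gens) /\
  (* subject to a (single, defining) relation B^2 = Delta^q Gamma^2 + J Phi *)
  (exists Phi : {mpoly F[3]},
     BB s ^+ 2 = Delta F ^+ q * Gam s ^+ 2
                 + JJ s * (Phi \mPo [tuple Delta F; JJ s; Gam s]) /\
     (forall P : {mpoly F[4]}, P \mPo gens = 0 ->
        exists Q : {mpoly F[4]},
          P = Q * relpoly q Phi)) /\
  (* SAGBI basis for grevlex with a0 < a1 < a2 *)
  is_SAGBI (sl2_invariant s) [:: Delta F; JJ s; Gam s; BB s].
Proof.
move=> p_pr p_gt2 n_gt0 pcharFp Fq_s q gens.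
have sP : odd_Fq p n s by split.
have [R RE] := B_relation sP.
split; last split; last split; last exact: SAGBI_generators sP.
- case=> [[|[|[|[|//]]]] lti]; rewrite (tnth_nth 0) /=.
  + exact: Delta_invariant.
  + exact: J_invariant sP.
  + exact: Gam_invariant sP.
  + exact: B_invariant sP.
- by move=> f; exact: (invariants_generated sP).
by exists R; split=> // P; exact: (relation_generates sP).
Qed.
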